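(* Let $U\subset\mathbb{R}^2$ be a simply connected open set with coordinates $(u,v)$. Suppose that $a,b,c,l$ and $m$ are functions on $U$ which satisfy the integrability conditions $$a_u=bl,\qquad b_u=-al+m,\qquad c_u=2b,\qquad l_v-m_u=0.$$ Then there exists a normal parametrized surface $F:U\to H^1$ having $a,b,c$ and $l,m$ as its coefficients of the first kind and of the second kind, respectively. In addition, if $\widetilde F:U\to H^1$ is another such normal parametrized surface, then it differs from $F$ by a Heisenberg rigid motion, that is, there exists $g\in PSH(1)$ such that $\widetilde F(u,v)=g\circ F(u,v)$ for all $(u,v)\in U$.
   Context: All functions and maps are smooth. $H^1$ is $\mathbb{R}^3$ with group law $(x_1,y_1,z_1)\circ(x_2,y_2,z_2)=(x_1+x_2,\,y_1+y_2,\,z_1+z_2+y_1x_2-x_1y_2)$ and left invariant vector fields $\mathring e_1=\partial_x+y\,\partial_z$, $\mathring e_2=\partial_y-x\,\partial_z$, $T=\partial_z$. The contact form is $\theta_0=dz+x\,dy-y\,dx$, the contact bundle is $\xi_0=\ker\theta_0=\mathrm{span}(\mathring e_1,\mathring e_2)$, and $J_0\mathring e_1=\mathring e_2$, $J_0\mathring e_2=-\mathring e_1$. $\langle\cdot,\cdot\rangle$ is the Riemannian metric on $H^1$ for which $\mathring e_1,\mathring e_2,T$ are orthonormal. $PSH(1)$ is the group of pseudohermitian transformations (Heisenberg rigid motions): diffeomorphisms $\Phi$ of $H^1$ with $\Phi^*\theta_0=\theta_0$ and $\Phi_*J_0=J_0\Phi_*$ on $\xi_0$. A point of a surface is singular if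 the tangent plane of the surface there equals the contact plane $\xi_0$; away from singular points the line field (tangent plane)$\,\cap\,\xi_0$ integrates to the characteristic foliation. A parametrized surface $F:U\to H^1$ is normal if (1) $F(U)$ is a surface without singular points; (2) $F_u=\partial F/\partial u$ defines the characteristic foliation on $F(U)$; (3) $|F_u|=1$ on $U$. For a normal $F$, put $X=F_u$, $Y=J_0X$; its coefficients of the first kind are $a=\langle F_v,X\rangle$, $b=\langle F_v,Y\rangle$, $c=\langle F_v,T\rangle$, and of the second kind $l=\langle F_{uu},Y\rangle$, $m=\langle F_{uv},Y\rangle$, where $F_{uu},F_{uv}$ are componentwise second partial derivatives of the $\mathbb{R}^3$-valued map $F$ (components with respect to $\partial_x,\partial_y,\partial_z$), regarded as tangent vectors at $F(u,v)$.
   Formalization: The function c is additionally assumed to have no zeros on U (surfaces are read as immersed): with a=b=c=l=m=0 the conditions hold but F_v=0, so no surface exists, and every normal surface has c nowhere zero. *)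

(* Defs.v *)
From mathcomp Require Import all_boot all_order all_algebra.
From mathcomp Require Import all_classical all_reals all_analysis.
From mathcomp Require Import ring.

Set Implicit Arguments.
Unset Strict Implicit.
Unset Printing Implicit Defensive.

Import Order.TTheory GRing.Theory Num.Theory.
Import numFieldNormedType.Exports.

Local Open Scope classical_set_scope.
Local Open Scope ring_scope.

Section Smooth.
Context {R : realType} {V W : normedModType R}.

(* Meant for an open [U] in a finite-dimensional [V]: continuity of the
   differential is continuity of its values ['D_v f] on each vector [v]. *)
Fixpoint Ck (k : nat) (U : set V) (f : V -> W) : Prop :=
  (forall p, U p -> {for p, continuous f}) /\
  match k with
  | 0 => True
  | k'.+1 => (forall p, U p -> differentiable f p) /\
      forall v : V, Ck k' U ('D_v f)
  end.

Definition smooth_on (U : set V) (f : V -> W) : Prop := forall k, Ck k U f.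

End Smooth.

Section SimplyConnected.
Context {R : realType} {V : normedModType R}.

Local Notation I := (`[0, 1]%classic : set R).

Definition path_connected (U : set V) : Prop :=
  forall p q, U p -> U q -> exists gamma : R -> V,
    [/\ {within I, continuous gamma}, forall t, I t -> U (gamma t),
        gamma 0 = p & gamma 1 = q].

Definition null_homotopic_in (U : set V) (gamma : R -> V) : Prop :=
  exists H : R * R -> V,
    [/\ {within I `*` I, continuous H},
        forall s t, I s -> I t -> U (H (s, t)),
        forall t, I t -> H (0, t) = gamma t /\ H (1, t) = gamma 0
      & forall s, I s -> H (s, 0) = gamma 0 /\ H (s, 1) = gamma 0].

Definition simply_connected (U : set V) : Prop :=
  path_connected U /\
  forall gamma : R -> V,
    {within I, continuous gamma} -> (forall t, I t -> U (gamma t)) ->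
    gamma 0 = gamma 1 -> null_homotopic_in U gamma.

End SimplyConnected.

Section Heisenberg.
Context {R : realType}.

(* Tangent vectors at any point are written in the basis d/dx, d/dy, d/dz. *)
Local Notation H1 := 'rV[R]_3.

Definition vec3 (x y z : R) : H1 := \row_i [:: x; y; z]`_i.

Definition xc (w : H1) : R := w 0 0.
Definition yc (w : H1) : R := w 0 1.
Definition zc (w : H1) : R := w 0 2.

Definition e1 (p : H1) : H1 := vec3 1 0 (yc p).
Definition e2 (p : H1) : H1 := vec3 0 1 (- xc p).
Definition e3 : H1 := vec3 0 0 1.

Definition theta0 (p w : H1) : R := zc w + xc p * yc w - yc p * xc w.

Definition contact_plane (p : H1) : set H1 := [set w | theta0 p w = 0].

(* The coordinates of [w] in the frame [e1 p, e2 p, e3] are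
   [xc w, yc w, theta0 p w] (see [frame_decomp]), so the two definitions below
   are the metric making that frame orthonormal, and J0 on the contact plane
   (extended by [J0 p e3 = 0] to all tangent vectors; only its values on the
   contact plane are used). *)
Definition inner (p v w : H1) : R :=
  xc v * xc w + yc v * yc w + theta0 p v * theta0 p w.

Definition J0 (p w : H1) : H1 := xc w *: e2 p - yc w *: e1 p.

Definition hnorm (p w : H1) : R := Num.sqrt (inner p w w).

Lemma vec3E x y z :
  (xc (vec3 x y z) = x) * (yc (vec3 x y z) = y) * (zc (vec3 x y z) = z).
Proof. by rewrite /xc /yc /zc !mxE. Qed.

Lemma frame_decomp (p w : H1) :
  w = xc w *: e1 p + yc w *: e2 p + theta0 p w *: e3.
Proof.
apply/rowP => -[[|[|[|//]]]] lti; rewrite !mxE /= /theta0 /xc /yc /zc.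
- by rewrite (_ : Ordinal lti = 0); [ring|exact: val_inj].
- by rewrite (_ : Ordinal lti = 1); [ring|exact: val_inj].
- by rewrite (_ : Ordinal lti = 2); [ring|exact: val_inj].
Qed.

Lemma frame_orthonormal (p : H1) :
  [/\ inner p (e1 p) (e1 p) = 1, inner p (e2 p) (e2 p) = 1, inner p e3 e3 = 1,
      inner p (e1 p) (e2 p) = 0
    & inner p (e1 p) e3 = 0 /\ inner p (e2 p) e3 = 0].
Proof. by rewrite /inner /theta0 !vec3E; split; [..|split]; ring. Qed.

Lemma J0_frame (p : H1) : J0 p (e1 p) = e2 p /\ J0 p (e2 p) = - e1 p.
Proof. by rewrite /J0 !vec3E !scale1r !scale0r subr0 sub0r. Qed.

(* Pseudohermitian transformations. *)
Definition PSH1 (Phi : H1 -> H1) : Prop :=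
  [/\ smooth_on setT Phi,
      exists Psi : H1 -> H1,
        [/\ smooth_on setT Psi, cancel Phi Psi & cancel Psi Phi],
      forall p w, theta0 (Phi p) ('d Phi p w) = theta0 p w
    & forall p w, contact_plane p w ->
        'd Phi p (J0 p w) = J0 (Phi p) ('d Phi p w)].

Definition eu : 'rV[R]_2 := delta_mx 0 0.
Definition ev : 'rV[R]_2 := delta_mx 0 1.

Definition tangent_plane (F : 'rV[R]_2 -> H1) (q : 'rV[R]_2) : set H1 :=
  range ('d F q).

(* Surfaces are immersed: self-intersections of F(U) are allowed, and the
   tangent plane is taken along [F]. *)
Definition normal_surface (U : set 'rV[R]_2) (F : 'rV[R]_2 -> H1) : Prop :=
  [/\ smooth_on U F,
      forall q, U q -> injective ('d F q),
      forall q, U q -> tangent_plane F q <> contact_plane (F q),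
      forall q, U q ->
        tangent_plane F q `&` contact_plane (F q) =
        [set w | exists k : R, w = k *: 'D_eu F q]
    & forall q, U q -> hnorm (F q) ('D_eu F q) = 1].

Definition has_coefficients (U : set 'rV[R]_2) (F : 'rV[R]_2 -> H1)
    (a b c l m : 'rV[R]_2 -> R) : Prop :=
  forall q, U q ->
    let X := 'D_eu F q in
    let Y := J0 (F q) X in
    [/\ a q = inner (F q) ('D_ev F q) X,
        b q = inner (F q) ('D_ev F q) Y,
        c q = inner (F q) ('D_ev F q) e3,
        l q = inner (F q) ('D_eu ('D_eu F) q) Y
      & m q = inner (F q) ('D_ev ('D_eu F) q) Y].

(* Hence, among given functions, only those with [c] nowhere zero can be the
   coefficients of a normal surface. *)
Lemma normal_surface_c_neq0 U F a b c l m :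
  normal_surface U F -> has_coefficients U F a b c l m ->
  forall q, U q -> c q != 0.
Proof.
move=> [smF injF _ folF _] coefF q Uq; apply/eqP => c0.
have [_ [dF _]] := smF 1%N; have {}dF := dF _ Uq.
have [_ _ cE _ _] := coefF _ Uq.
have thetav : contact_plane (F q) ('D_ev F q).
  by move: cE; rewrite c0 /contact_plane /inner /= [theta0 _ e3]/theta0 !vec3E
    !mulr0 subr0 !add0r addr0 mulr1.
have : (tangent_plane F q `&` contact_plane (F q)) ('D_ev F q).
  by split=> //; exists ev => //; rewrite -deriveE.
rewrite folF// => -[k]; rewrite !deriveE// -linearZ => /(injF _ Uq)/rowP/(_ 1).
by rewrite !mxE /= mulr0 => /eqP; rewrite oner_eq0.
Qed.

Definition integrability_conditions (U : set 'rV[R]_2)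
    (a b c l m : 'rV[R]_2 -> R) : Prop :=
  forall q, U q ->
    [/\ 'D_eu a q = b q * l q,
        'D_eu b q = - a q * l q + m q,
        'D_eu c q = 2 * b q
      & 'D_ev l q - 'D_eu m q = 0].

End Heisenberg.

(* Main.v *)
(* Write F = (x, y, z) and F_u = X1 e1 + X2 e2 with X1^2 + X2^2 = 1. As c
   has no zeros, F is normal with the given coefficients if and only if
     X1_u = - l X2,  X1_v = - m X2,   X2_u = l X1,  X2_v = m X1,
     x_u = X1,  x_v = a X1 - b X2,    y_u = X2,  y_v = a X2 + b X1,
     z_u = y x_u - x y_u,  z_v = c + y x_v - x y_v.
   Existence: with (X1, X2) = (cos phi, sin phi), this asks for primitives of
   four 1-forms, for phi, x, y and z in turn, and the integrability conditions
   say exactly that each of them is closed.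
   Uniqueness: two solutions (X1, X2) differ by a constant rotation, after which
   the two triples (x, y, z) differ by a left translation.

   On a simply connected U a closed form is exact: its integrals over the sides
   of small boxes are additive, so sums over subdivisions of a path do not depend
   on the (fine) subdivision and vanish on null-homotopic loops, as one sees by
   moving through a grid row by row. *)

(* The reduction to a first-order system rests on two facts. [Y] is horizontal, so the inner product
   with [Y] ignores the third component of F_uu and F_uv; and |F_u| = 1 makes their first two
   components orthogonal to those of F_u. Hence l and m determine all derivatives of (X1, X2). As
   theta0(F_u) = 0 and theta0(F_v) = c, a nonzero c is what makes F an immersion without singular
   points. The obstacle is that the paths and homotopies defining simple connectedness are only
   continuous, so a 1-form cannot be integrated along them. A function [w p q] of two nearby points
   replaces the integral; Green's theorem on rectangles makes it additive on small triangles, and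
   the homotopy argument uses nothing else. The angle phi serves existence only, where it makes X1^2
   + X2^2 = 1 automatic. Uniqueness compares two unit fields through their dot product and
   determinant, so no angle function has to be lifted. *)
Require Import Defs.
From mathcomp Require Import all_boot all_order all_algebra.
From mathcomp Require Import all_classical all_reals all_analysis.
From mathcomp Require Import ring lra.
Import Order.TTheory GRing.Theory Num.Theory.
Import numFieldNormedType.Exports.
Local Open Scope classical_set_scope.
Local Open Scope ring_scope.

Set Implicit Arguments.
Unset Strict Implicit.
Unset Printing Implicit Defensive.

(** * Signed integrals of continuous functions *)

Section OneVariable.
Context {R : realType}.
Implicit Types (f g A : R -> R) (a b c e x : R).

Definition between a b x := Num.min a b <= x <= Num.max a b.

Lemma between_sym a b x : between a b x = between b a x.
Proof. by rewrite /between minC maxC. Qed.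

Lemma between_le a b x : a <= b -> between a b x = (a <= x <= b).
Proof. by move=> ab; rewrite /between min_l// max_r. Qed.

Lemma betweenl a b : between a b a.
Proof. by rewrite /between ge_min le_max !lexx. Qed.

Lemma between_ball c e a b x :
  ball c e a -> ball c e b -> between a b x -> ball c e x.
Proof.
rewrite -!ball_normE /= /between => ca cb.
case: (leP a b) => ab /andP[ax xb]; rewrite !ltr_distl in ca cb *; lra.
Qed.

Lemma is_derive1_continuous f x df : is_derive x 1 f df -> {for x, continuous f}.
Proof. by move=> [/derivable1_diffP/differentiable_continuous]. Qed.

Lemma MVT_between f df a b :
  (forall x, between a b x -> is_derive x 1 f (df x)) ->
  exists2 c, between a b c & f b - f a = df c * (b - a).
Proof.
wlog ab : a b / a <= b.
  move=> H; have [ab|/ltW ba] := leP a b; first exact: H.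
  move=> dfP; have [x|c cb E] := H b a ba; first by rewrite between_sym; exact: dfP.
  by exists c; rewrite 1?between_sym// -opprB E -mulrN opprB.
move=> dfP; have [||c] := @MVT_segment R f df a b ab.
- move=> x /itvP xab; apply: dfP; rewrite between_le// !xab//.
- apply/continuous_in_subspaceT => x; rewrite inE/= in_itv/= => xab.
  by apply/is_derive1_continuous/dfP; rewrite between_le.
- by rewrite in_itv/= => cab E; exists c => //; rewrite between_le.
Qed.

(** The fundamental theorem gives a two-sided derivative only in the interior of the interval of
    integration. The open ball leaves room to enlarge the segment on both sides. *)
Lemma antiderivative_exists g c e a b :
  (forall x, ball c e x -> {for x, continuous g}) -> ball c e a -> ball c e b ->
  exists A, forall x, between a b x -> is_derive x 1 A (g x).
Proof.
wlog ab : a b / a <= b.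
  move=> H gc ca cb; have [ab|/ltW ba] := leP a b; first exact: H.
  by have [A AP] := H b a ba gc cb ca; exists A => x; rewrite between_sym; exact: AP.
move=> gc; rewrite -!ball_normE /= => ca cb.
(* Midpoints between the segment's ends and the ball's ends: strictly outside the segment, strictly
   inside the ball. *)
pose s := (a + (c - e)) / 2; pose t := (b + (c + e)) / 2.
have gint : (@lebesgue_measure R).-integrable `[s, t] (EFin \o g).
  apply: continuous_compact_integrable; first exact: segment_compact.
  apply/continuous_in_subspaceT => x; rewrite inE/= in_itv/= /s /t => st.
  by apply: gc; rewrite -ball_normE /=; rewrite !ltr_distl in ca cb *; lra.
pose A y := (\int[lebesgue_measure]_(t in `[s, y]) g t)%R.
exists A => x.
rewrite between_le// => /andP[ax xb].
have sx : s < x by rewrite /s; rewrite !ltr_distl in ca cb; lra.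
have xt : x < t by rewrite /t; rewrite !ltr_distl in ca cb; lra.
have [|] := continuous_FTC1_closed xt gint sx.
  by apply: gc; rewrite -ball_normE /=; rewrite !ltr_distl in ca cb *; lra.
by rewrite -/A => dA <-; rewrite derive1E; exact: derivableP.
Qed.

(* The integral of [g] from [a] to [b], with sign when [b < a]: it is meant
   for a continuous [g], which has an antiderivative [A]. *)
Definition oint g a b : R := get [set w | exists A,
  (forall x, between a b x -> is_derive x 1 A (g x)) /\ w = A b - A a].

(** Two antiderivatives differ by a constant, so the one that [get] picks does not matter. *)
Lemma ointE g A a b : (forall x, between a b x -> is_derive x 1 A (g x)) ->
  oint g a b = A b - A a.
Proof.
move=> dA; rewrite /oint; case: xgetP => [_ -> [B [dB ->]]|/(_ (A b - A a))[]];
  last by exists A.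
have [x xab|c _] := @MVT_between (B - A) (fun=> 0) a b.
  by have := is_deriveB (dB x xab) (dA x xab); rewrite subrr.
by rewrite mul0r !fctE; lra.
Qed.


Lemma between_trans a b x y z :
  between a b x -> between a b y -> between x y z -> between a b z.
Proof.
by rewrite /between; case: (leP a b); case: (leP x y) => ? ? ? ? ?; lra.
Qed.

Section Continuous.
Variables (g : R -> R) (c e : R).
Hypothesis gc : forall x, ball c e x -> {for x, continuous g}.

(** One antiderivative on the hull of the three points computes all three integrals. *)
Lemma oint_chasles a b d : ball c e a -> ball c e b -> ball c e d ->
  oint g a b + oint g b d = oint g a d.
Proof.
move=> ca cb cd; pose m := Num.min a (Num.min b d).
pose M := Num.max a (Num.max b d).
have [A dA] : exists A, forall x, between m M x -> is_derive x 1 A (g x).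
  apply: antiderivative_exists gc _ _.
  - by rewrite /m; case: (leP b d) => _; case: leP.
  - by rewrite /M; case: (leP b d) => _; case: leP.
have mM : m <= M by rewrite ge_min /M le_max lexx.
have ma : between m M a by rewrite between_le// /m /M ge_min le_max !lexx.
have mb : between m M b.
  by rewrite between_le// /m /M !ge_min !le_max !lexx !orbT.
have md : between m M d.
  by rewrite between_le// /m /M !ge_min !le_max !lexx !orbT.
have oA x y : between m M x -> between m M y -> oint g x y = A y - A x.
  by move=> mx my; apply: ointE => z xyz; exact/dA/(between_trans mx my).
by rewrite !oA//; lra.
Qed.

Lemma ointxx a : ball c e a -> oint g a a = 0.
Proof. by move=> ca; have := oint_chasles ca ca ca; lra. Qed.

Lemma oint_mean a b : ball c e a -> ball c e b ->
  exists2 x, between a b x & oint g a b = g x * (b - a).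
Proof.
move=> ca cb; have [A dA] := antiderivative_exists gc ca cb.
by rewrite (ointE dA); exact: MVT_between.
Qed.

(** The antiderivative behind [oint g a y] may vary with [y]. Near [x], additivity rewrites the
    integral as a constant plus the increment of one fixed antiderivative on a segment around
    [x]. *)
Lemma is_derive_oint a x : ball c e a -> ball c e x ->
  is_derive x 1 (oint g a) (g x).
Proof.
move=> ca cx.
have [s [t [cs ct sxt]]] : exists s t, [/\ ball c e s, ball c e t & s < x < t].
  exists ((c - e + x) / 2), ((c + e + x) / 2); rewrite -!ball_normE /= in cx *.
  by rewrite !ltr_distl in cx *; split; lra.
have [A dA] := antiderivative_exists gc cs ct.
have dAx : is_derive x 1 (fun y => oint g a s + (A y - A s)) (g x).
  rewrite -[g x]add0r; apply: is_deriveD; rewrite -[g x]subr0.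
  apply: is_deriveB; apply: dA; rewrite between_le; lra.
apply: near_eq_is_derive dAx.
have : \forall y \near x, y \in `]s, t[ by apply: near_in_itvoo; rewrite in_itv.
apply: filterS => y; rewrite in_itv /= => syt.
have cy : ball c e y by apply: between_ball cs ct _; rewrite between_le; lra.
rewrite -(oint_chasles ca cs cy); congr (_ + _); apply/esym/ointE => z zb.
apply: dA; move: zb; apply: between_trans; first exact: betweenl.
by rewrite between_le; lra.
Qed.

End Continuous.

Lemma eq_is_derive0 c e f a b : (forall x, ball c e x -> is_derive x 1 f 0) ->
  ball c e a -> ball c e b -> f a = f b.
Proof.
move=> df ca cb; have [|x _] := @MVT_between f (fun=> 0) a b.
  by move=> x abx; apply/df/(between_ball ca cb abx).
by lra.
Qed.

End OneVariable.

(** * Green's theorem on a rectangle *)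

(** A division-free criterion, which makes sense at [h = 0] too; it suits estimates of increments of
    an integral. *)
Lemma is_derive1_bound {R : realType} (f : R -> R) (x a : R) :
  (forall eta, 0 < eta ->
    \forall h \near 0, `|f (h + x) - f x - h * a| <= eta * `|h|) ->
  is_derive x 1 f a.
Proof.
move=> fP.
have fa : h^-1 *: ((f \o shift x) (h *: 1) - f x) @[h --> 0^'] --> a.
  apply/cvgrPdist_le => eta eta0; near=> h.
  have h0 : h != 0 by near: h; exact: nbhs_dnbhs_neq.
  rewrite distrC /= [h *: 1]mulr1 -(@ler_pM2r _ `|h|) ?normr_gt0// -normrM.
  rewrite mulrBl [_ *: _]mulrC mulfVK// [a * h]mulrC.
  by near: h; apply: nbhs_dnbhs; exact: fP.
by apply: DeriveDef; [apply/cvg_ex; exists a|exact: cvg_lim].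
Unshelve. all: by end_near. Qed.

Section Rectangle.
Context {R : realType}.
Variables (P Q D : R -> R -> R) (c1 c2 e : R).
Hypothesis Pc : forall u v : R, ball c1 e u -> ball c2 e v ->
  {for u, continuous (P ^~ v)}.
Hypothesis Qc : forall u v : R, ball c1 e u -> ball c2 e v -> {for v, continuous (Q u)}.
Hypothesis dP : forall u v : R, ball c1 e u -> ball c2 e v ->
  is_derive v 1 (P u) (D u v).
Hypothesis dQ : forall u v : R, ball c1 e u -> ball c2 e v ->
  is_derive u 1 (Q ^~ v) (D u v).
Hypothesis Dc : forall u v : R, ball c1 e u -> ball c2 e v ->
  {for (u, v), continuous (fun z : R * R => D z.1 z.2)}.

(** Compactness of the segment makes the continuity of [D] in its first variable uniform in the
    second. *)
Lemma near_segment_uniform (u v0 v1 eta : R) :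
  ball c1 e u -> ball c2 e v0 -> ball c2 e v1 -> 0 < eta ->
  \forall h \near 0, forall t, between v0 v1 t -> `|D (h + u) t - D u t| <= eta.
Proof.
move=> cu cv0 cv1 eta0.
have cpt := @segment_compact R (Num.min v0 v1) (Num.max v0 v1).
move/compact_near_coveringP: cpt => /(_ R (nbhs 0)
  (fun h t => `|D (h + u) t - D u t| <= eta)) H.
have {H} := H _ _; apply=> t; rewrite /= in_itv /= => tv.
have ct := between_ball cv0 cv1 tv.
  have /cvgrPdist_lt/(_ (eta / 2)) := Dc cu ct.
  move=> /(_ ltac:(lra)) /nbhs_ballP [d /= d0 dD].
  exists (ball t d, ball 0 d) => [|[t' h] /= [tt' hd]].
    by split; exact: nbhsx_ballx.
  have := dD (h + u, t'); have := dD (u, t').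
  rewrite /= => /(_ (conj (ballxx _ d0) tt')) D1.
  have uh : ball u d (h + u).
    by move: hd; rewrite -!ball_normE /= sub0r opprD addrCA subrr addr0.
  move=> /(_ (conj uh tt')) D2.
  by rewrite !ltr_distl in D1 D2; rewrite ler_distl; lra.
Qed.

(** Differentiation under the integral sign. As [D] is also the derivative of [P] in [v], the
    integral of [D u] is already known to be the increment of [P u], so the error is estimated by
    two applications of the mean value theorem. *)
Lemma is_derive_oint_param (u v0 v1 : R) :
  ball c1 e u -> ball c2 e v0 -> ball c2 e v1 ->
  is_derive u 1 (fun s => oint (Q s) v0 v1) (P u v1 - P u v0).
Proof.
move=> cu cv0 cv1; apply: is_derive1_bound => eta eta0.
(* The added 1 keeps [w] positive when [v0 = v1], so that one can divide by it. *)
pose w := `|v1 - v0| + 1.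
have w0 : 0 < w by rewrite ltr_wpDl.
have unif : \forall h \near 0, forall t, between v0 v1 t -> forall s,
    between 0 h s -> `|D (s + u) t - D u t| <= eta / w.
  have [d /= d0 dD] := near_segment_uniform cu cv0 cv1 (divr_gt0 eta0 w0).
  exists d => //= h hd t tv s sh; apply: dD => //=.
  exact: (between_ball (ballxx _ d0) hd sh).
near=> h.
have ch : ball c1 e (h + u).
  near: h; have : \forall s \near u, ball c1 e s.
    by apply: open_nbhs_nbhs; split => //; exact: ball_open.
  by rewrite (near_shift 0) /= subr0.
have [A dA] := antiderivative_exists (fun v => Qc cu) cv0 cv1.
have [B dB] := antiderivative_exists (fun v => Qc ch) cv0 cv1.
rewrite (ointE dA) (ointE dB).
(* This function of [t] is an antiderivative of the first-order error of [Q] in [u], so its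
   increment is the error to be bounded. *)
have [t tv|t tv] := @MVT_between R (B - A - h \*: P u)
    (fun t => Q (h + u) t - Q u t - h *: D u t) v0 v1.
  by apply: is_deriveB; [exact: is_deriveB (dB _ tv) (dA _ tv)|
    exact/is_deriveZ/dP/(between_ball cv0 cv1 tv)].
have [s us|s us Qs] := @MVT_between R (Q ^~ t) (D ^~ t) u (h + u).
  by apply: dQ; [exact: between_ball us|exact: between_ball tv].
rewrite Qs addrK !fctE => E.
have -> : B v1 - B v0 - (A v1 - A v0) - h * (P u v1 - P u v0) =
    h * (D s t - D u t) * (v1 - v0).
  have scE (x y : R) : x *: (y : R) = x * y by [].
  rewrite /= !scE in E.
  by transitivity ((D s t * h - h * D u t) * (v1 - v0)); [rewrite -E|]; ring.
have Dst : `|D s t - D u t| <= eta / w.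
  rewrite -[s](subrK u).
  have: forall t, between v0 v1 t -> forall s,
    between 0 h s -> `|D (s + u) t - D u t| <= eta / w by near: h.
  apply=> //; move: us; rewrite /between.
  by case: (leP u (h + u)); case: (leP 0 h) => ? ? ?; lra.
rewrite !normrM -mulrA mulrC ler_wpM2r//.
have -> : eta = eta / w * w by rewrite mulfVK// gt_eqF.
by apply: ler_pM => //; rewrite /w lerDl.
Unshelve. all: by end_near. Qed.

(** Slide the right side of the rectangle: the integral over it, corrected by the horizontal sides
    swept so far, has zero derivative in its position. *)
Lemma oint_rectangle (u0 u1 v0 v1 : R) :
  ball c1 e u0 -> ball c1 e u1 -> ball c2 e v0 -> ball c2 e v1 ->
  oint (P ^~ v0) u0 u1 + oint (Q u1) v0 v1 =
  oint (Q u0) v0 v1 + oint (P ^~ v1) u0 u1.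
Proof.
move=> cu0 cu1 cv0 cv1.
pose E u := oint (Q u) v0 v1 - (oint (P ^~ v1) u0 u - oint (P ^~ v0) u0 u).
have Pc' (v : R) : ball c2 e v ->
    forall u : R, ball c1 e u -> {for u, continuous (P ^~ v)}.
  by move=> cv u cu; exact: Pc.
have : E u0 = E u1.
  apply: (eq_is_derive0 _ cu0 cu1) => u cu.
  have d0 := is_derive_oint (Pc' _ cv0) cu0 cu.
  have d1 := is_derive_oint (Pc' _ cv1) cu0 cu.
  have := is_deriveB (is_derive_oint_param cu cv0 cv1) (is_deriveB d1 d0).
  by rewrite subrr.
by rewrite /E !(ointxx (Pc' _ _) cu0)//; lra.
Qed.

End Rectangle.

(** * Exactness of cochains on simply connected sets *)

Section Uniform.
Context {R : realType} {T : pseudoMetricType R} {V : normedModType R}.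

(** A Lebesgue number: one radius serves along a whole path or homotopy. *)
Lemma compact_image_thickening (K : set T) (H : T -> V) (U : set V) :
  compact K -> {within K, continuous H} -> open U -> (forall x, K x -> U (H x)) ->
  exists2 e : R, 0 < e & forall x, K x -> ball (H x) e `<=` U.
Proof.
move=> /compact_near_coveringP cK /subspace_continuousP cH oU HU.
pose P (r : R) x := K x -> ball (H x) r `<=` U.
have [|e /= e0 eP] := cK R (0^'+) P _.
  move=> x Kx; have /nbhs_ballP[e /= e0 eU] := open_nbhs_nbhs (conj oU (HU _ Kx)).
  have e20 : 0 < e / 2 by lra.
  have /cvg_ballP/(_ _ e20) := cH _ Kx; rewrite /= near_withinE => xP.
  (* Half of the radius is spent on moving from [H x] to [H y], half on the ball around [H y]. *)
  exists ([set y | K y -> ball (H x) (e / 2) (H y)], [set r | r < e / 2]) => /=.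
    by split => //; exact: nbhs_right_lt.
  move=> [y r] /= [yP re] Ky z zr; apply: eU.
  rewrite [e]splitr; apply: ball_triangle (yP Ky) _.
  by apply: le_ball zr; exact: ltW.
exists (e / 2); first lra.
by move=> x Kx; apply: (eP (e / 2)) => //=; rewrite ?sub0r ?normrN ?gtr0_norm; lra.
Qed.

Lemma compact_uniform_continuous (K : set T) (H : T -> V) (e : R) :
  compact K -> {within K, continuous H} -> 0 < e ->
  exists2 d : R, 0 < d &
    forall x y, K x -> K y -> ball x d y -> ball (H x) e (H y).
Proof.
move=> /compact_near_coveringP cK /subspace_continuousP cH e0.
pose P (r : R) x := K x -> forall y, K y -> ball x r y -> ball (H x) e (H y).
have [|d /= d0 dP] := cK R (0^'+) P _.
  move=> x Kx; have e20 : 0 < e / 2 by lra.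
  have /cvg_ballP/(_ _ e20) := cH _ Kx; rewrite /= near_withinE.
  move=> /nbhs_ballP[d /= d0 xP].
  have d20 : 0 < d / 2 by lra.
  exists (ball x (d / 2), [set r | r < d / 2]) => /=.
    by split; [exact: nbhsx_ballx|exact: nbhs_right_lt].
  move=> [y r] /= [xy rd] Ky z Kz yz.
  rewrite [e]splitr; apply: (@ball_triangle _ _ (H x)).
    by apply/ball_sym/xP => //; apply: le_ball xy; lra.
  apply: xP => //; rewrite [d]splitr; apply: ball_triangle xy _.
  by apply: le_ball yz; exact: ltW.
exists (d / 2); first lra.
move=> x y Kx Ky xy.
by apply: (dP (d / 2)) xy => //=; rewrite ?sub0r ?normrN ?gtr0_norm; lra.
Qed.

End Uniform.

Section Cochain.
Context {R : realType} {V : normedModType R}.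
Variables (U : set V) (w : V -> V -> R).
Hypothesis openU : open U.
Hypothesis cocycle : forall p e q r, ball p e `<=` U -> ball p e q -> ball p e r ->
  w p q + w q r = w p r.

(** The cocycle condition covers only triangles with a vertex at the centre of the ball; the three
    such triangles over the sides of [q r s] give the general case. *)
Lemma cochain_trans p e q r s : ball p e `<=` U ->
  ball p e q -> ball p e r -> ball p e s -> w q r + w r s = w q s.
Proof.
move=> pU pq pr ps; have := cocycle pU pq pr; have := cocycle pU pr ps.
by have := cocycle pU pq ps; lra.
Qed.

Lemma cochain_diag p e q : ball p e `<=` U -> ball p e q -> w q q = 0.
Proof. by move=> pU pq; have := cochain_trans pU pq pq pq; lra. Qed.

Lemma cochain_diagU p : U p -> w p p = 0.
Proof.
move=> Up; have /nbhs_ballP[e /= e0 eU] := open_nbhs_nbhs (conj openU Up).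
by apply: (cochain_diag eU); exact: ballxx.
Qed.

Lemma cochain_anti p e q r : ball p e `<=` U -> ball p e q -> ball p e r ->
  w q r = - w r q.
Proof.
move=> pU pq pr; have := cochain_trans pU pq pr pq.
by rewrite (cochain_diag pU pq); lra.
Qed.

Lemma chain_sum_ball (x : nat -> V) p e n : ball p e `<=` U ->
  (forall k, (k <= n)%N -> ball p e (x k)) ->
  \sum_(k < n) w (x k) (x k.+1) = w (x 0%N) (x n).
Proof.
move=> pU; elim: n => [|n IHn] px.
  by rewrite big_ord0 (cochain_diag pU (px _ _)).
rewrite big_ord_recr /= IHn; last by move=> k kn; apply/px/ltnW.
by apply: (cochain_trans pU); apply: px.
Qed.

Local Notation I := (`[0, 1]%classic : set R).

(** A discrete line integral, meaningful for paths that are only continuous. *)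
Definition path_sum (n : nat) (gamma : R -> V) : R :=
  \sum_(k < n) w (gamma (k%:R / n%:R)) (gamma (k.+1%:R / n%:R)).

Lemma unit_fraction (k n : nat) : (k <= n)%N -> (0 < n)%N -> I (k%:R / n%:R).
Proof.
move=> kn n0; have n0' : 0 < n%:R :> R by rewrite ltr0n.
by rewrite /= in_itv /= divr_ge0//= ler_pdivrMr// mul1r ler_nat.
Qed.

Lemma near_inv_lt (d : R) : 0 < d -> \forall n \near \oo, n%:R^-1 < d.
Proof.
move=> d0; near=> n.
have n0 : 0 < n%:R :> R by rewrite ltr0n; near: n; exact: nbhs_infty_gt.
rewrite invf_plt// ?posrE//; near: n; exact: nbhs_infty_gtr.
Unshelve. all: by end_near. Qed.

(** The [m] small steps inside one coarse step stay in a single ball contained in [U], where the sum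
    telescopes to the coarse term. *)
Lemma path_sum_refine gamma e (n m : nat) : (0 < n)%N -> (0 < m)%N ->
  (forall t, I t -> ball (gamma t) e `<=` U) ->
  (forall s t, I s -> I t -> `|s - t| <= n%:R^-1 -> ball (gamma s) e (gamma t)) ->
  path_sum (n * m) gamma = path_sum n gamma.
Proof.
move=> n0 m0 gU fine; rewrite /path_sum.
have n0' : 0 < n%:R :> R by rewrite ltr0n.
have m0' : 0 < m%:R :> R by rewrite ltr0n.
have ratE i : (i * m)%:R / (n * m)%:R = i%:R / n%:R :> R.
  by rewrite !natrM; field; rewrite !gt_eqF.
suff H i : (i <= n)%N ->
    \sum_(k < i * m) w (gamma (k%:R / (n * m)%:R)) (gamma (k.+1%:R / (n * m)%:R)) =
    \sum_(k < i) w (gamma (k%:R / n%:R)) (gamma (k.+1%:R / n%:R)) by exact: H.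
elim: i => [_|i IHi ilt]; first by rewrite mul0n !big_ord0.
rewrite mulSn addnC -[LHS](big_mkord xpredT (fun k =>
  w (gamma (k%:R / (n * m)%:R)) (gamma (k.+1%:R / (n * m)%:R)))).
rewrite (big_cat_nat (n := (i * m)%N)) ?leq_addr//= big_mkord IHi; last exact: ltnW.
rewrite big_ord_recr /=; congr (_ + _).
rewrite -{1}[(i * m)%N]add0n big_addn addKn big_mkord.
have Ii : I (i%:R / n%:R) by apply: unit_fraction => //; exact: ltnW.
rewrite (@chain_sum_ball (fun k => gamma ((k + i * m)%:R / (n * m)%:R))
  (gamma (i%:R / n%:R)) e) ?add0n.
- by rewrite ratE -mulSn ratE.
- exact: gU.
- move=> k km; apply: fine => //.
    apply: unit_fraction; last by rewrite muln_gt0 n0.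
    by rewrite (leq_trans _ (leq_mul ilt (leqnn m)))// mulSn leq_add2r.
  rewrite natrD mulrDl ratE opprD addrCA subrr addr0 normrN natrM.
  rewrite ger0_norm; last by rewrite divr_ge0// mulr_ge0// ltW.
  rewrite ler_pdivrMr ?mulr_gt0//.
  by rewrite mulrA mulVf ?mul1r ?ler_nat// gt_eqF.
Qed.

(** Any two sufficiently fine subdivisions, into [n] and [N] steps, are compared with their common
    refinement into [n * N] steps. *)
Lemma path_sum_eventually_cst gamma : {within I, continuous gamma} ->
  (forall t, I t -> U (gamma t)) ->
  exists s, \forall n \near \oo, path_sum n gamma = s.
Proof.
move=> gc gU.
have [e e0 eU] := compact_image_thickening (@segment_compact _ _ _) gc openU gU.
have [d d0 dg] := compact_uniform_continuous (@segment_compact _ _ _) gc e0.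
have fine : \forall n \near \oo, (0 < n)%N /\ forall s t : R, I s -> I t ->
    `|s - t| <= n%:R^-1 -> ball (gamma s) e (gamma t).
  near=> n; split; first by near: n; exact: nbhs_infty_gt.
  move=> s t Is It st; apply: dg => //; rewrite -ball_normE /=.
  by apply: le_lt_trans st _; near: n; exact: near_inv_lt.
have [N _ NP] := fine; exists (path_sum N gamma); near=> n.
have [n0 nf] : (0 < n)%N /\ forall s t : R, I s -> I t ->
    `|s - t| <= n%:R^-1 -> ball (gamma s) e (gamma t) by near: n.
have [N0 Nf] := NP N (leqnn _).
by rewrite -(path_sum_refine n0 N0 eU nf) mulnC (path_sum_refine N0 n0 eU Nf).
Unshelve. all: by end_near. Qed.

(** Every square of an [n] by [n] grid maps into a ball in [U], so adjacent rows have equal sums.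
    The first row is the sum along [gamma]; the last is constant, hence contributes 0. *)
Lemma null_homotopic_path_sum gamma : null_homotopic_in U gamma ->
  \forall n \near \oo, path_sum n gamma = 0.
Proof.
move=> [H [Hc HU H01 Hs]].
have cII : compact (I `*` I) by apply: compact_setX; exact: segment_compact.
have HU' x : (I `*` I) x -> U (H x) by case: x => s t [/= Is It]; exact: HU.
have [e e0 eU] := compact_image_thickening cII Hc openU HU'.
have [d d0 dH] := compact_uniform_continuous cII Hc e0.
near=> n.
have n0 : (0 < n)%N by near: n; exact: nbhs_infty_gt.
have n0' : 0 < n%:R :> R by rewrite ltr0n.
pose h i j := H (i%:R / n%:R, j%:R / n%:R).
have step (k : nat) : `|k%:R / n%:R - k.+1%:R / n%:R| < d :> R.
  rewrite -mulrBl -natr1 opprD addrA subrr add0r mulN1r normrN gtr0_norm ?invr_gt0//.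
  by near: n; exact: near_inv_lt.
have fine i j i' j' : (i < n)%N -> (j < n)%N -> (i <= i' <= i.+1)%N ->
    (j <= j' <= j.+1)%N -> ball (h i j) e (h i' j').
  move=> ilt jlt ii' jj'; apply: dH.
  - by split => /=; apply: unit_fraction => //; exact: ltnW.
  - split => /=; apply: unit_fraction => //.
      by case/andP: ii' => _ /leq_trans; exact.
    by case/andP: jj' => _ /leq_trans; exact.
  - have close k k' : (k <= k' <= k.+1)%N -> ball (k%:R / n%:R : R) d (k'%:R / n%:R).
      move=> /andP[]; rewrite leq_eqVlt => /predU1P[<- _|]; first exact: ballxx.
      move=> kk' k'k; have -> : k' = k.+1 by apply/eqP; rewrite eqn_leq k'k.
      by rewrite -ball_normE; exact: step.
    by split; [exact: close ii'|exact: close jj'].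
pose row i := \sum_(j < n) w (h i j) (h i j.+1).
have rowS i : (i < n)%N -> row i = row i.+1.
  move=> ilt.
  have hU j : (j < n)%N -> ball (h i j) e `<=` U.
    by move=> jlt; apply: eU; split => /=; apply: unit_fraction => //; exact: ltnW.
  (* The first [j] squares of the strip: going along row [i] and then across equals going across and
     then along row [i.+1]. For [j = n] both crossings join the base point to itself. *)
  suff H' j : (j <= n)%N -> \sum_(k < j) w (h i k) (h i k.+1) + w (h i j) (h i.+1 j) =
      w (h i 0%N) (h i.+1 0%N) + \sum_(k < j) w (h i.+1 k) (h i.+1 k.+1).
    have Hi0 : h i 0%N = gamma 0.
      by rewrite /h mul0r; apply: (Hs _ _).1; apply: unit_fraction => //; exact: ltnW.
    have HiS0 : h i.+1 0%N = gamma 0.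
      by rewrite /h mul0r; apply: (Hs _ _).1; exact: unit_fraction.
    have Hin : h i n = gamma 0.
      rewrite /h divff ?gt_eqF//; apply: (Hs _ _).2.
      by apply: unit_fraction => //; exact: ltnW.
    have HiSn : h i.+1 n = gamma 0.
      by rewrite /h divff ?gt_eqF//; apply: (Hs _ _).2; exact: unit_fraction.
    have := H' n (leqnn _); rewrite Hi0 HiS0 Hin HiSn cochain_diagU; last first.
      by rewrite -Hi0; apply: (hU 0%N n0); exact: ballxx.
    by rewrite addr0 add0r.
  elim: j => [_|j IHj jlt]; first by rewrite !big_ord0 addr0 add0r.
  rewrite !big_ord_recr /=; have := IHj (ltnW jlt).
  have c i' j' := @fine i j i' j' ilt jlt.
  have c00 := c i j; have c01 := c i j.+1.
  have c10 := c i.+1 j; have c11 := c i.+1 j.+1.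
  rewrite !leqnn !leqnSn /= in c00 c01 c10 c11.
  (* The diagonal cuts the square into two triangles. *)
  have := cochain_trans (hU j jlt) (c00 _ _) (c01 _ _) (c11 _ _).
  have := cochain_trans (hU j jlt) (c00 _ _) (c10 _ _) (c11 _ _).
  by move=> /(_ isT isT isT isT isT isT) T1 /(_ isT isT isT isT isT isT) T2; lra.
have -> : path_sum n gamma = row 0%N.
  apply: eq_bigr => j _; rewrite /h mul0r.
  have Ij := unit_fraction (ltnW (ltn_ord j)) n0.
  by rewrite !(H01 _ _).1//; exact: unit_fraction.
have -> : row 0%N = row n.
  have : (n <= n)%N by []; elim: {1 3}n => // k IHk kn.
  by rewrite IHk 1?rowS// ltnW.
rewrite /row big1// => j _; rewrite /h divff ?gt_eqF//.
have I0 : I 0 by rewrite /= in_itv /= lexx ler01.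
have Ij := unit_fraction (ltnW (ltn_ord j)) n0.
rewrite !(H01 _ _).2//; last exact: unit_fraction.
by rewrite cochain_diagU// -(H01 0 I0).1; apply: HU => //.
Unshelve. all: by end_near. Qed.

(* The retraction of the line onto [0, 1]: precomposing with it makes a path
   continuous on the whole line. *)
Definition clamp (t : R) : R := Num.max 0 (Num.min 1 t).

Lemma clamp_I t : I (clamp t).
Proof. by rewrite /= in_itv /= /clamp le_max lexx ge_max ler01 ge_min lexx. Qed.

Lemma clamp_id t : I t -> clamp t = t.
Proof. by rewrite /= in_itv /= /clamp => /andP[? ?]; rewrite min_r ?max_r. Qed.

Lemma clamp_le0 t : t <= 0 -> clamp t = 0.
Proof. by move=> t0; rewrite /clamp max_l// ge_min t0 orbT. Qed.

Lemma clamp_ge1 t : 1 <= t -> clamp t = 1.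
Proof. by move=> t1; rewrite /clamp min_l// max_r ?ler01. Qed.

Lemma continuous_clamp : continuous clamp.
Proof.
move=> t; apply: continuous_max; first exact: cvg_cst.
by apply: continuous_min; [exact: cvg_cst|exact: cvg_id].
Qed.

Lemma continuous_comp_clamp (gamma : R -> V) (h : R -> R) :
  {within I, continuous gamma} -> continuous h ->
  continuous (fun t => gamma (clamp (h t))).
Proof.
move=> /subspace_continuousP gc hc t.
apply: (@cvg_comp _ _ _ (clamp \o h) gamma _ (within I (nbhs (clamp (h t))))).
  move=> A [/= e e0 eA].
  have /cvgrPdist_lt/(_ _ e0) : (clamp \o h) x @[x --> t] --> clamp (h t).
    by apply: continuous_comp; [exact: hc|exact: continuous_clamp].
  by apply: filterS => s hs; apply: eA => //; exact: clamp_I.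
exact/gc/clamp_I.
Qed.

Section Concatenation.
Variables (q r : V) (g1 g2 g3 : R -> V).
Hypotheses (c1 : {within I, continuous g1}) (c2 : {within I, continuous g2})
  (c3 : {within I, continuous g3}).
Hypotheses (g11 : g1 1 = q) (g20 : g2 0 = q) (g21 : g2 1 = r) (g30 : g3 0 = r).

(* Adding up the clamped pieces avoids gluing. *)
Definition concat3 (t : R) : V := g1 (clamp (3 * t)) +
  (g2 (clamp (3 * t - 1)) - q) + (g3 (clamp (3 * t - 2)) - r).

Lemma continuous_concat3 : continuous concat3.
Proof.
have lc (x : R) : continuous (fun t : R => 3 * t - x).
  move=> t; apply: cvgB; last exact: cvg_cst.
  by apply: cvgM; [exact: cvg_cst|exact: cvg_id].
have lc0 : continuous (fun t : R => 3 * t).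
  by move=> t; apply: cvgM; [exact: cvg_cst|exact: cvg_id].
move=> t; apply: cvgD; [apply: cvgD|].
- exact: (continuous_comp_clamp c1 lc0).
- by apply: cvgB; [exact: (continuous_comp_clamp c2 (lc 1))|exact: cvg_cst].
- by apply: cvgB; [exact: (continuous_comp_clamp c3 (lc 2))|exact: cvg_cst].
Qed.

Lemma concat3_1 t : I t -> concat3 (t / 3) = g1 t.
Proof.
move=> It; have /= := It; rewrite in_itv /= => t01.
rewrite /concat3 mulrC mulfVK// clamp_id// (@clamp_le0 (t - 1)); last by lra.
by rewrite clamp_le0 ?g20 ?g30 ?subrr ?addr0//; lra.
Qed.

Lemma concat3_2 t : I t -> concat3 ((t + 1) / 3) = g2 t.
Proof.
move=> It; have /= := It; rewrite in_itv /= => t01.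
rewrite /concat3 mulrC mulfVK// addrK (clamp_id It).
rewrite (@clamp_ge1 (t + 1)); last by lra.
rewrite (@clamp_le0 (t + 1 - 2)); last by lra.
by rewrite g11 g30 subrr addr0 addrC subrK.
Qed.

Lemma concat3_3 t : I t -> concat3 ((t + 2) / 3) = g3 t.
Proof.
move=> It; have /= := It; rewrite in_itv /= => t01.
rewrite /concat3 mulrC mulfVK// addrK (clamp_id It).
rewrite (@clamp_ge1 (t + 2)); last by lra.
rewrite (@clamp_ge1 (t + 2 - 1)); last by lra.
by rewrite g11 g21 addrC [q + _]addrC subrK subrK.
Qed.

Lemma concat3_in (t : R) : (forall t, I t -> U (g1 t)) ->
  (forall t, I t -> U (g2 t)) -> (forall t, I t -> U (g3 t)) ->
  I t -> U (concat3 t).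
Proof.
move=> U1 U2 U3; rewrite /= in_itv /= => t01.
have [t1|t1] := leP (3 * t) 1.
  have -> : t = (3 * t) / 3 by rewrite mulrC mulKf.
  by rewrite concat3_1 /= ?in_itv /=; [apply: U1; rewrite /= in_itv /=|]; lra.
have [t2|t2] := leP (3 * t) 2.
  have -> : t = (3 * t - 1 + 1) / 3 by rewrite subrK mulrC mulKf.
  by rewrite concat3_2 /= ?in_itv /=; [apply: U2; rewrite /= in_itv /=|]; lra.
have -> : t = (3 * t - 2 + 2) / 3 by rewrite subrK mulrC mulKf.
by rewrite concat3_3 /= ?in_itv /=; [apply: U3; rewrite /= in_itv /=|]; lra.
Qed.

Lemma path_sum_concat3 n : (0 < n)%N ->
  path_sum (3 * n) concat3 = path_sum n g1 + path_sum n g2 + path_sum n g3.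
Proof.
move=> n0; have n0' : 0 < n%:R :> R by rewrite ltr0n.
have frac (k i : nat) : (k + i * n)%:R / (3 * n)%:R = (k%:R / n%:R + i%:R) / 3 :> R.
  by rewrite natrD !natrM; field; rewrite gt_eqF.
rewrite /path_sum (_ : 3 * n = n + (n + n))%N; last by rewrite !mulSn addn0.
rewrite !big_split_ord /= -addrA; congr (_ + (_ + _)); apply: eq_bigr => k _.
- have -> : (n + (n + n) = 3 * n)%N by rewrite !mulSn addn0.
  have := frac k 0%N; have := frac k.+1 0%N; rewrite !addn0 !addr0 => -> ->.
  by rewrite !concat3_1//; apply: unit_fraction => //; exact: ltnW.
- have -> : (n + (n + n) = 3 * n)%N by rewrite !mulSn addn0.
  have -> : ((n + k).+1 = k.+1 + 1 * n)%N by rewrite mul1n addSn addnC.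
  have -> : (n + k = k + 1 * n)%N by rewrite mul1n addnC.
  rewrite !frac.
  by rewrite !concat3_2//; apply: unit_fraction => //; exact: ltnW.
- have -> : (n + (n + n) = 3 * n)%N by rewrite !mulSn addn0.
  have -> : ((n + (n + k)).+1 = k.+1 + 2 * n)%N.
    by rewrite mul2n -addnn addSn addnA addnC.
  have -> : (n + (n + k) = k + 2 * n)%N by rewrite mul2n -addnn addnA addnC.
  rewrite !frac.
  by rewrite !concat3_3//; apply: unit_fraction => //; exact: ltnW.
Qed.

End Concatenation.

(** The cochain is known to be antisymmetric only for points in a common ball inside [U]; this is
    why the subdivision must be fine. *)
Lemma path_sum_rev n e (gamma : R -> V) : (0 < n)%N ->
  (forall t, I t -> ball (gamma t) e `<=` U) ->
  (forall s t, I s -> I t -> `|s - t| <= n%:R^-1 -> ball (gamma s) e (gamma t)) ->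
  path_sum n (fun t => gamma (1 - t)) = - path_sum n gamma.
Proof.
move=> n0 gU fine; rewrite /path_sum -sumrN [LHS](reindex_inj rev_ord_inj) /=.
have n0' : n%:R != 0 :> R by rewrite pnatr_eq0 -lt0n.
apply: eq_bigr => k _.
have rE (i : nat) : (i <= n)%N -> 1 - (n - i)%:R / n%:R = i%:R / n%:R :> R.
  by move=> i_n; rewrite natrB// mulrBl divff// subKr.
rewrite rE// subnSK// rE; last exact: ltnW.
have Ik := unit_fraction (ltnW (ltn_ord k)) n0.
have IkS := unit_fraction (ltn_ord k) n0.
have close : `|k%:R / n%:R - k.+1%:R / n%:R| <= n%:R^-1 :> R.
  by rewrite -mulrBl -natr1 opprD addrA subrr add0r mulN1r normrN ger0_norm ?invr_ge0.
have kS := fine _ _ Ik IkS close.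
by apply: (cochain_anti (gU _ Ik)) => //; apply: fine => //; rewrite subrr normr0.
Qed.

(** The potential at [q] is the eventual sum along a chosen path from a base point. The loop that
    follows the path to [p], the segment to [q] and the reversed path from [q] has sum 0, and on the
    segment the sum collapses to [w p q]. *)
Lemma cochain_exact : simply_connected U ->
  exists f : V -> R, forall p e q,
    ball p e `<=` U -> ball p e q -> f q - f p = w p q.
Proof.
move=> [pcU scU].
have [[p0 Up0]|U0] := pselect (exists p, U p); last first.
  by exists (fun=> 0) => p e q pU /pU Uq; case: U0; exists q.
pose gamma q := xget (fun=> p0) [set g : R -> V | [/\ {within I, continuous g},
    forall t, I t -> U (g t), g 0 = p0 & g 1 = q]].
have gammaP q : U q -> [/\ {within I, continuous (gamma q)},
    forall t, I t -> U (gamma q t), gamma q 0 = p0 & gamma q 1 = q].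
  move=> Uq; have [g gP] := pcU _ _ Up0 Uq.
  by rewrite /gamma; case: xgetP => [? -> //|/(_ g)]; case.
pose f q := get [set s | \forall n \near \oo, path_sum n (gamma q) = s].
have fP q : U q -> \forall n \near \oo, path_sum n (gamma q) = f q.
  move=> Uq; have [gc gU _ _] := gammaP q Uq.
  have [s sP] := path_sum_eventually_cst gc gU.
  by rewrite /f; case: xgetP => [? -> //|/(_ s)]; case.
exists f => p e q pU pq.
have e0 : 0 < e by rewrite -ball_normE in pq; exact: le_lt_trans pq.
have Up : U p by apply/pU/ballxx.
have Uq : U q by exact: pU.
have [pc pgU gp0 gp1] := gammaP p Up; have [qc qgU gq0 gq1] := gammaP q Uq.
pose seg (t : R) := p + t *: (q - p).
have segc : {within I, continuous seg}.
  apply: continuous_subspaceT => t; apply: cvgD; first exact: cvg_cst.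
  by apply: cvgZr_tmp; exact: cvg_id.
have seg_ball t : I t -> ball p e (seg t).
  rewrite /= in_itv /= -ball_normE /= => /andP[t0 t1].
  rewrite opprD addrA subrr add0r normrN normrZ ger0_norm// distrC.
  by rewrite -ball_normE /= in pq; apply: le_lt_trans pq; rewrite ler_piMl.
have segU t : I t -> U (seg t) by move=> /seg_ball/pU.
pose rev t := gamma q (1 - t).
have revI t : I t -> I (1 - t) by rewrite /= !in_itv /= => ?; lra.
have revc : {within I, continuous rev}.
  apply/subspace_continuousP => t It.
  apply: (@cvg_comp _ _ _ (fun t => 1 - t) (gamma q) _ (within I (nbhs (1 - t)))).
    move=> A [/= d d0 dA]; exists d => //= s ts Is; apply: dA; last exact: revI.
    by rewrite /= opprB addrC addrA subrK distrC.
  by move/subspace_continuousP: qc; apply; exact: revI.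
have revU t : I t -> U (rev t) by move=> /revI/qgU.
have seg0 : seg 0 = p by rewrite /seg scale0r addr0.
have seg1 : seg 1 = q by rewrite /seg scale1r addrC subrK.
have rev0 : rev 0 = q by rewrite /rev subr0.
have rev1 : rev 1 = p0 by rewrite /rev subrr.
pose loop := concat3 p q (gamma p) seg rev.
have I0 : I 0 by rewrite /= in_itv /= lexx ler01.
have I1 : I 1 by rewrite /= in_itv /= lexx ler01.
have loop0 : loop 0 = p0.
  by rewrite -(mul0r (3^-1)) /loop (concat3_1 _ seg0 rev0).
have loop1 : loop 1 = p0.
  have -> : 1 = (1 + 2) / 3 :> R by field.
  by rewrite /loop (concat3_3 _ gp1 seg1).
have loopc : {within I, continuous loop}.
  by apply: continuous_subspaceT; exact: continuous_concat3.
have loopU t : I t -> U (loop t).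
  exact: (concat3_in gp1 seg0 seg1 rev0 pgU segU revU).
have [d d0 dU] := compact_image_thickening (@segment_compact _ _ _) qc openU qgU.
have [h h0 dh] := compact_uniform_continuous (@segment_compact _ _ _) qc d0.
(* Multiples of 3 put the two junctions of the loop at subdivision points. *)
have loop_sum : \forall n \near \oo, path_sum (3 * n) loop = 0.
  have [N _ NP] := null_homotopic_path_sum
    (scU _ loopc loopU (etrans loop0 (esym loop1))).
  exists N => // n /= Nn; apply: NP => /=; apply: leq_trans Nn _; exact: leq_pmull.
near \oo => n.
have n0 : (0 < n)%N by near: n; exact: nbhs_infty_gt.
have : path_sum (3 * n) loop = 0 by near: n.
rewrite (path_sum_concat3 gp1 seg0 seg1 rev0 n0).
have -> : path_sum n (gamma p) = f p by near: n; exact: fP.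
rewrite (path_sum_rev n0 dU); last first.
  move=> s t Is It st; apply: dh => //; rewrite -ball_normE /=.
  by apply: le_lt_trans st _; near: n; exact: near_inv_lt.
have -> : path_sum n (gamma q) = f q by near: n; exact: fP.
rewrite /path_sum (@chain_sum_ball (fun k => seg (k%:R / n%:R)) p e)//.
  rewrite mul0r seg0 divff ?seg1; last by rewrite pnatr_eq0 -lt0n.
  by lra.
by move=> k kn; apply/seg_ball/unit_fraction.
Unshelve. all: by end_near. Qed.

End Cochain.

(** * The Poincare lemma in the plane *)

Section Plane.
Context {R : realType}.
Local Notation plane := 'rV[R]_2.
Implicit Types (u v : R) (p q : plane).

Definition pt u v : plane := \row_i [:: u; v]`_i.

Lemma ptE0 u v : pt u v 0 0 = u. Proof. by rewrite mxE. Qed.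
Lemma ptE1 u v : pt u v 0 1 = v. Proof. by rewrite mxE. Qed.

Lemma plane_ext p q : p 0 0 = q 0 0 -> p 0 1 = q 0 1 -> p = q.
Proof.
move=> E0 E1; apply/rowP => -[[|[|//]] lti].
- by rewrite (_ : Ordinal lti = 0)//; exact: val_inj.
- by rewrite (_ : Ordinal lti = 1)//; exact: val_inj.
Qed.

Lemma ptK p : pt (p 0 0) (p 0 1) = p.
Proof. by apply: plane_ext; rewrite mxE. Qed.

(** Row vectors carry the sup norm, so balls are squares; horizontal-then-vertical paths from the
    centre stay inside. *)
Lemma ball_planeP p e q :
  ball p e q <-> ball (p 0 0) e (q 0 0) /\ ball (p 0 1) e (q 0 1).
Proof.
split=> [[_ pq]|[pq0 pq1]]; first by split; exact: pq.
split=> [|i j]; first by rewrite -ball_normE in pq0; exact: le_lt_trans pq0.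
rewrite ord1; case: j => -[|[|//]] lti.
- by rewrite (_ : Ordinal lti = 0)//; exact: val_inj.
- by rewrite (_ : Ordinal lti = 1)//; exact: val_inj.
Qed.

Lemma ball_pt p e u v : ball (p 0 0) e u -> ball (p 0 1) e v -> ball p e (pt u v).
Proof. by move=> pu pv; apply/ball_planeP; rewrite ptE0 ptE1. Qed.

Lemma continuous_pt : continuous (fun z : R * R => pt z.1 z.2).
Proof.
move=> [u v]; apply/cvg_ballP => e e0; exists (ball u e, ball v e) => /=.
  by split; exact: nbhsx_ballx.
by move=> [u' v'] [/= ? ?]; apply: ball_pt; rewrite ?ptE0 ?ptE1.
Qed.

Lemma continuous_pt1 v : continuous (fun u => pt u v).
Proof.
move=> u; apply/cvg_ballP => e e0; apply/nbhs_ballP; exists e => // u' uu'.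
by apply: ball_pt; rewrite ?ptE0 ?ptE1//; exact: ballxx.
Qed.

Lemma continuous_pt2 u : continuous (fun v => pt u v).
Proof.
move=> v; apply/cvg_ballP => e e0; apply/nbhs_ballP; exists e => // v' vv'.
by apply: ball_pt; rewrite ?ptE0 ?ptE1//; exact: ballxx.
Qed.

Lemma is_derive_pt1 (f : plane -> R) u v : differentiable f (pt u v) ->
  is_derive u 1 (fun s => f (pt s v)) ('D_eu f (pt u v)).
Proof.
move=> /(@diff_derivable _ _ _ _ _ eu) df.
have E : (fun h : R => h^-1 *: (((fun s => f (pt s v)) \o shift u) (h *: 1)
      - f (pt u v))) =
    (fun h : R => h^-1 *: ((f \o shift (pt u v)) (h *: eu) - f (pt u v))).
  apply/funext => h /=; congr (_ *: (f _ - _)).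
  by apply: plane_ext; rewrite !mxE /= ?mulr1 ?mulr0 ?add0r// [h *: 1]mulr1.
by apply: DeriveDef; rewrite /derivable /derive E.
Qed.

Lemma is_derive_pt2 (f : plane -> R) u v : differentiable f (pt u v) ->
  is_derive v 1 (fun s => f (pt u s)) ('D_ev f (pt u v)).
Proof.
move=> /(@diff_derivable _ _ _ _ _ ev) df.
have E : (fun h : R => h^-1 *: (((fun s => f (pt u s)) \o shift v) (h *: 1)
      - f (pt u v))) =
    (fun h : R => h^-1 *: ((f \o shift (pt u v)) (h *: ev) - f (pt u v))).
  apply/funext => h /=; congr (_ *: (f _ - _)).
  by apply: plane_ext; rewrite !mxE /= ?mulr1 ?mulr0 ?add0r// [h *: 1]mulr1.
by apply: DeriveDef; rewrite /derivable /derive E.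
Qed.

Lemma is_derive_coord m n (i : 'I_m) (j : 'I_n) (x v : 'M[R]_(m, n)) :
  is_derive x v (fun y => y i j) (v i j).
Proof.
apply: DeriveDef; first exact/diff_derivable/differentiable_coord.
have /(congr1 (fun M : 'M[R]_(m, n) => M i j)) :=
  derive_mx (@derivable_id R 'M[R]_(m, n) x v).
by rewrite derive_id mxE.
Qed.

(** Subtracting the expected linear part of a map reduces its differentiability to this estimate. *)
Lemma is_diff0_bound {V W : normedModType R} (g : V -> W) (x : V) :
  (forall eta, 0 < eta -> \forall h \near 0, `|g (h + x) - g x| <= eta * `|h|) ->
  is_diff x g 0.
Proof.
move=> gP.
have E : g \o shift x = cst (g x) + (\0 : V -> W) +o_ (0 : V) id.
  apply/eqaddoP => eta eta0; move: (gP _ eta0); apply: filterS => h.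
  by rewrite !fctE addr0.
have c0 : continuous (\0 : V -> W) by move=> y; exact: cvg_cst.
have d0 : 'd g x = \0 :> (V -> W) by exact: (diff_unique c0 E).
by apply: DiffDef => //; apply/diff_locallyP; rewrite d0.
Qed.

End Plane.

Section Primitive.
Context {R : realType}.
Local Notation plane := 'rV[R]_2.
Variables (U : set plane) (P Q : plane -> R).
Hypothesis openU : open U.
Hypothesis dP : forall q, U q -> differentiable P q.
Hypothesis dQ : forall q, U q -> differentiable Q q.
Hypothesis closed : forall q, U q -> 'D_ev P q = 'D_eu Q q.
Hypothesis dPc : forall q, U q -> {for q, continuous ('D_ev P)}.

(* The integral of [P du + Q dv] from [p] to [q] along a horizontal and then a
   vertical segment. *)
Definition corner_integral (p q : plane) : R :=
  oint (fun u => P (pt u (p 0 1))) (p 0 0) (q 0 0) +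
  oint (fun v => Q (pt (q 0 0) v)) (p 0 1) (q 0 1).

Let cP1 (p : plane) e : ball p e `<=` U -> forall v : R, ball (p 0 1) e v ->
  forall u : R, ball (p 0 0) e u -> {for u, continuous (fun u => P (pt u v))}.
Proof.
move=> pU v pv u pu; apply: continuous_comp; first exact: continuous_pt1.
exact/differentiable_continuous/dP/pU/ball_pt.
Qed.

Let cQ2 (p : plane) e : ball p e `<=` U -> forall u : R, ball (p 0 0) e u ->
  forall v : R, ball (p 0 1) e v -> {for v, continuous (fun v => Q (pt u v))}.
Proof.
move=> pU u pu v pv; apply: continuous_comp; first exact: continuous_pt2.
exact/differentiable_continuous/dQ/pU/ball_pt.
Qed.

(** The corner paths from [p] via [q] to [r] and from [p] directly to [r] differ by the boundary of
    the rectangle with opposite corners [(q 0 0, p 0 1)] and [(r 0 0, q 0 1)]; Green's theorem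
    applies there, and additivity in each variable does the rest. *)
Lemma corner_integral_cocycle p e q r : ball p e `<=` U ->
  ball p e q -> ball p e r ->
  corner_integral p q + corner_integral q r = corner_integral p r.
Proof.
move=> pU pq pr; rewrite /corner_integral.
have [pq0 pq1] := (ball_planeP _ _ _).1 pq.
have [pr0 pr1] := (ball_planeP _ _ _).1 pr.
have e0 : 0 < e by case: pq.
have p0 : ball (p 0 0) e (p 0 0) by exact: ballxx.
have p1 : ball (p 0 1) e (p 0 1) by exact: ballxx.
have rect := @oint_rectangle R (fun u v => P (pt u v)) (fun u v => Q (pt u v))
  (fun u v => 'D_ev P (pt u v)) (p 0 0) (p 0 1) e.
have {rect} : oint (fun u => P (pt u (p 0 1))) (q 0 0) (r 0 0) +
    oint (fun v => Q (pt (r 0 0) v)) (p 0 1) (q 0 1) =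
    oint (fun v => Q (pt (q 0 0) v)) (p 0 1) (q 0 1) +
    oint (fun u => P (pt u (q 0 1))) (q 0 0) (r 0 0).
  apply: rect => //.
  - by move=> u v pu pv; apply: (cP1 pU).
  - by move=> u v pu pv; apply: (cQ2 pU).
  - by move=> u v pu pv; apply/is_derive_pt2/dP/pU/ball_pt.
  - move=> u v pu pv; have Uuv : U (pt u v) by exact/pU/ball_pt.
    by rewrite closed//; exact/is_derive_pt1/dQ.
  - move=> u v pu pv; apply: (@continuous_comp _ _ _ (fun z => pt z.1 z.2) ('D_ev P)).
      exact: continuous_pt.
    exact/dPc/pU/ball_pt.
have := oint_chasles (cP1 pU p1) p0 pq0 pr0.
have := oint_chasles (cQ2 pU pr0) p1 pq1 pr1.
by lra.
Qed.

Lemma closed_form_exact : simply_connected U ->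
  exists f : plane -> R, forall q, U q ->
    [/\ differentiable f q, 'D_eu f q = P q & 'D_ev f q = Q q].
Proof.
move=> scU.
have [f fP] := cochain_exact openU corner_integral_cocycle scU.
exists f => q Uq.
pose L (x : plane) := P q * x 0 0 + Q q * x 0 1.
have dL (v : plane) : is_derive q v L (L v).
  by apply: is_deriveD; apply: is_deriveZ; exact: is_derive_coord.
have diffL : differentiable L q.
  by apply: differentiableD; apply: differentiableZ; exact: differentiable_coord.
(* It suffices that [f] minus its candidate linear part [L] has zero differential at [q]. *)
have g0 : is_diff q (f - L) 0.
  apply: is_diff0_bound => eta eta0.
  have /nbhs_ballP[e /= e0 eU] := open_nbhs_nbhs (conj openU Uq).
  have eta20 : 0 < eta / 2 by lra.
  have /cvgrPdist_le/(_ _ eta20)/nbhs_ballP[d1 /= d10 P1] :=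
    differentiable_continuous (dP Uq).
  have /cvgrPdist_le/(_ _ eta20)/nbhs_ballP[d2 /= d20 P2] :=
    differentiable_continuous (dQ Uq).
  pose d := Num.min e (Num.min d1 d2).
  have d0 : 0 < d by rewrite !lt_min e0 d10 d20.
  apply/nbhs_ballP; exists d => //= h; rewrite -ball_normE /= sub0r normrN => hd.
  have qh : ball q d (h + q).
    by rewrite -ball_normE /= opprD addrCA subrr addr0 normrN.
  have [qh0 qh1] := (ball_planeP _ _ _).1 qh.
  have q0 : ball (q 0 0) d (q 0 0) by exact: ballxx.
  have q1 : ball (q 0 1) d (q 0 1) by exact: ballxx.
  have dle : [/\ d <= e, d <= d1 & d <= d2].
    by split; rewrite !ge_min lexx ?orbT.
  have [de dd1 dd2] := dle.
  have qdU : ball q d `<=` U by move=> x /(le_ball de); exact: eU.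
  have -> : (f - L) (h + q) - (f - L) q = corner_integral q (h + q) - L h.
    rewrite !fctE -(fP q d (h + q) qdU qh) /L !mxE; ring.
  rewrite /corner_integral.
  (* Each leg of the corner path becomes a value of [P] or [Q] at a point near [q] times the length
     of the leg, so continuity at [q] bounds the error. *)
  have [s qs ->] := oint_mean (cP1 qdU q1) q0 qh0.
  have [t qt ->] := oint_mean (cQ2 qdU qh0) q1 qh1.
  rewrite !mxE !addrK.
  have hP : `|P q - P (pt s (q 0 1))| <= eta / 2.
    by apply: P1; apply: (le_ball dd1); apply: ball_pt => //; exact: between_ball qs.
  have hQ : `|Q q - Q (pt (h 0 0 + q 0 0) t)| <= eta / 2.
    apply: P2; apply: (le_ball dd2); apply: ball_pt; last exact: between_ball qt.
    by rewrite mxE in qh0.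
  have hn j : `|h 0 j| <= `|h|.
    by rewrite [leRHS]/Num.norm /= mx_normrE; exact: (le_bigmax _ _ (0, j)).
  have -> : P (pt s (q 0 1)) * h 0 0 + Q (pt (h 0 0 + q 0 0) t) * h 0 1 - L h =
      - ((P q - P (pt s (q 0 1))) * h 0 0 + (Q q - Q (pt (h 0 0 + q 0 0) t)) * h 0 1).
    by rewrite /L; ring.
  rewrite normrN (le_trans (ler_normD _ _))// !normrM [eta]splitr mulrDl.
  by apply: lerD; apply: ler_pM.
have fE : f = (f - L) + L by rewrite subrK.
have dg : differentiable (f - L) q by exact: ex_diff.
have Dg v : is_derive q v (f - L) 0.
  by apply: DeriveDef; [exact: diff_derivable|rewrite deriveE// diff_val].
have Df v : is_derive q v f (L v).
  by rewrite fE -[L v]add0r; exact: is_deriveD.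
split.
- by rewrite fE; exact: differentiableD.
- by rewrite (@derive_val _ _ _ _ _ _ _ (Df eu)) /L !mxE /= mulr1 mulr0 addr0.
- by rewrite (@derive_val _ _ _ _ _ _ _ (Df ev)) /L !mxE /= mulr1 mulr0 add0r.
Qed.

End Primitive.

(** * Calculus of smooth functions *)

Section SmoothCalculus.
Context {R : realType} {V : normedModType R}.
Variable U : set V.
Hypothesis openU : open U.

Lemma near_eq_differentiable {W : normedModType R} (f g : V -> W) (x : V) :
  (\near x, f x = g x) -> differentiable f x -> differentiable g x.
Proof.
move=> fg df; have d0 : is_diff x (g - f) 0.
  apply: is_diff0_bound => eta eta0.
  have : \forall h \near 0, f (h + x) = g (h + x).
    by have := fg; rewrite (near_shift 0) /= subr0.
  apply: filterS => h E.
  by rewrite !fctE E subrr (nbhs_singleton fg) subrr subrr normr0 mulr_ge0// ltW.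
have -> : g = (g - f) + f by rewrite subrK.
by apply: differentiableD => //; exact: ex_diff.
Qed.

Lemma near_open {W : Type} (f g : V -> W) (x : V) :
  (forall y, U y -> f y = g y) -> U x -> \near x, f x = g x.
Proof.
by move=> fg Ux; apply: filterS (open_nbhs_nbhs (conj openU Ux)) => y; exact: fg.
Qed.

(** Equality on an open set is equality near each of its points, hence passes to derivatives. *)
Lemma Ck_eq {W : normedModType R} k (f g : V -> W) :
  (forall x, U x -> f x = g x) -> Ck k U f -> Ck k U g.
Proof.
elim: k f g => [|k IHk] f g fg [cf df]; split.
- move=> p Up; rewrite /prop_for /continuous_at -(fg _ Up).
  by apply: cvg_trans (cf _ Up); apply: near_eq_cvg; exact: near_open.
- by [].
- move=> p Up; rewrite /prop_for /continuous_at -(fg _ Up).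
  by apply: cvg_trans (cf _ Up); apply: near_eq_cvg; exact: near_open.
- case: df => df Dk; split=> [p Up|v].
    by apply: near_eq_differentiable (df _ Up); exact: near_open.
  by apply: IHk (Dk v) => p Up; apply: near_eq_derive; exact: near_open.
Qed.

Lemma CkS {W : normedModType R} k (f : V -> W) : Ck k.+1 U f -> Ck k U f.
Proof.
elim: k f => [|k IHk] f [cf [df Dk]]; first by split.
by split=> //; split=> // v; exact: IHk.
Qed.

Lemma Ck_differentiable {W : normedModType R} k (f : V -> W) :
  (forall x, U x -> differentiable f x) -> (forall v, Ck k U ('D_v f)) ->
  Ck k.+1 U f.
Proof.
by move=> df Dk; split=> [p Up|]; [exact/differentiable_continuous/df|split].
Qed.

Lemma smooth_differentiable {W : normedModType R} (f : V -> W) :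
  smooth_on U f -> forall x, U x -> differentiable f x.
Proof. by move=> /(_ 1%N)[_ []]. Qed.

Lemma smooth_derive {W : normedModType R} (f : V -> W) v :
  smooth_on U f -> smooth_on U ('D_v f).
Proof. by move=> fs k; have [_ [_]] := fs k.+1; exact. Qed.

Lemma smooth_eq {W : normedModType R} (f g : V -> W) :
  (forall x, U x -> f x = g x) -> smooth_on U f -> smooth_on U g.
Proof. by move=> fg fs k; exact: Ck_eq (fs k). Qed.

Lemma smooth_cst {W : normedModType R} (c : W) : smooth_on U (cst c).
Proof.
move=> k; elim: k c => [|k IHk] c; first by split=> // p _; exact: cvg_cst.
apply: Ck_differentiable => [x _|v]; first exact: differentiable_cst.
by apply: Ck_eq (IHk 0) => x _; rewrite derive_cst.
Qed.

Lemma Ck_add {W : normedModType R} k (f g : V -> W) :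
  Ck k U f -> Ck k U g -> Ck k U (fun x => f x + g x).
Proof.
elim: k f g => [|k IHk] f g [cf df] [cg dg].
  by split=> // p Up; apply: cvgD; [exact: cf|exact: cg].
case: df dg => df Df [dg Dg].
apply: Ck_differentiable => [x Ux|v].
  by apply: differentiableD; [exact: df|exact: dg].
apply: Ck_eq (IHk _ _ (Df v) (Dg v)) => x Ux.
by rewrite -deriveD//; apply: diff_derivable; [exact: df|exact: dg].
Qed.

Lemma smooth_add {W : normedModType R} (f g : V -> W) :
  smooth_on U f -> smooth_on U g -> smooth_on U (fun x => f x + g x).
Proof. by move=> fs gs k; exact: Ck_add. Qed.

Lemma Ck_mul k (f g : V -> R) :
  Ck k U f -> Ck k U g -> Ck k U (fun x => f x * g x).
Proof.
elim: k f g => [|k IHk] f g.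
  by move=> [cf _] [cg _]; split=> // p Up; apply: cvgM; [exact: cf|exact: cg].
move=> fk gk; have [_ [df Df]] := fk; have [_ [dg Dg]] := gk.
apply: Ck_differentiable => [x Ux|v].
  by apply: differentiableM; [exact: df|exact: dg].
have := Ck_add (IHk _ _ (CkS fk) (Dg v)) (IHk _ _ (CkS gk) (Df v)).
apply: Ck_eq => x Ux.
by rewrite -[RHS]/('D_v (f * g) x) deriveM//;
  apply: diff_derivable; [exact: df|exact: dg].
Qed.

Lemma smooth_mul (f g : V -> R) :
  smooth_on U f -> smooth_on U g -> smooth_on U (fun x => f x * g x).
Proof. by move=> fs gs k; exact: Ck_mul. Qed.

Lemma smooth_opp (f : V -> R) : smooth_on U f -> smooth_on U (fun x => - f x).
Proof.
move=> fs; have := smooth_mul (smooth_cst (- 1 : R)) fs.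
by apply: smooth_eq => x _; rewrite mulN1r.
Qed.

Lemma smooth_sub (f g : V -> R) :
  smooth_on U f -> smooth_on U g -> smooth_on U (fun x => f x - g x).
Proof. by move=> fs /smooth_opp; exact: smooth_add. Qed.

Lemma is_derive_comp_real (g : R -> R) (f : V -> R) (x v : V) (dg : R) :
  is_derive (f x) 1 g dg -> differentiable f x ->
  differentiable (g \o f) x /\ 'D_v (g \o f) x = 'D_v f x * dg.
Proof.
move=> gD df; have dg' : differentiable g (f x) by apply/derivable1_diffP; case: gD.
split; first exact: differentiable_comp.
rewrite deriveE; last exact: differentiable_comp.
rewrite diff_comp//= -(deriveE _ df) diff1E//= [_ *: _]/(_ * _).
by congr (_ * _); rewrite derive1E; case: gD.
Qed.

(** Joint induction: the derivative of each function involves the other. *)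
Lemma Ck_cos_sin k (f : V -> R) :
  Ck k U f -> Ck k U (cos \o f) /\ Ck k U (sin \o f).
Proof.
elim: k f => [|k IHk] f.
  move=> [cf _]; split; split=> // p Up; apply: continuous_comp; try exact: cf.
    exact: continuous_cos.
  exact: continuous_sin.
move=> fk; have [_ [df Df]] := fk; have [Ckc Cks] := IHk _ (CkS fk).
have dc x v : U x -> _ := fun Ux =>
  @is_derive_comp_real cos f x v _ (is_derive_cos _) (df x Ux).
have ds x v : U x -> _ := fun Ux =>
  @is_derive_comp_real sin f x v _ (is_derive_sin _) (df x Ux).
split; apply: Ck_differentiable => [x Ux|v].
- by have [] := dc x 0 Ux.
- have C1 := Ck_mul (@smooth_cst R (- 1) k) Cks.
  have := Ck_mul (Df v) C1.
  by apply: Ck_eq => x Ux; rewrite (dc x v Ux).2 /= mulN1r.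
- by have [] := ds x 0 Ux.
- have := Ck_mul (Df v) Ckc.
  by apply: Ck_eq => x Ux; rewrite (ds x v Ux).2.
Qed.

Lemma smooth_cos (f : V -> R) : smooth_on U f -> smooth_on U (cos \o f).
Proof. by move=> fs k; have [] := Ck_cos_sin (fs k). Qed.

Lemma smooth_sin (f : V -> R) : smooth_on U f -> smooth_on U (sin \o f).
Proof. by move=> fs k; have [] := Ck_cos_sin (fs k). Qed.

Lemma differentiable_mx m n (F : V -> 'M[R]_(m, n)) (x : V) :
  (forall i j, differentiable (fun y => F y i j) x) -> differentiable F x.
Proof.
move=> dF.
have -> : F = \sum_(i < m) \sum_(j < n) (fun y => F y i j *: delta_mx i j).
  apply/funext => y; rewrite fct_sumE [LHS]matrix_sum_delta.
  by apply: eq_bigr => i _; rewrite fct_sumE.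
apply: differentiable_sum => i; apply: differentiable_sum => j.
exact: differentiableZl.
Qed.

Lemma derive_mx_coord m n (F : V -> 'M[R]_(m, n)) (x v : V) i j :
  differentiable F x -> 'D_v F x i j = 'D_v (fun y => F y i j) x.
Proof. by move=> dF; rewrite derive_mx ?mxE//; exact: diff_derivable. Qed.

Lemma Ck_mx m n k (F : V -> 'M[R]_(m, n)) :
  (forall i j, Ck k U (fun x => F x i j)) -> Ck k U F.
Proof.
elim: k F => [|k IHk] F FC.
  split=> // p Up; apply/cvg_ballP => e e0.
  have : \forall y \near p, forall ij : 'I_m * 'I_n,
      ball (F p ij.1 ij.2) e (F y ij.1 ij.2).
    apply: filter_forall => -[i j] /=.
    by have [/(_ _ Up)/cvg_ballP/(_ _ e0)] := FC i j.
  by apply: filterS => y H; split=> // i j; exact: (H (i, j)).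
have dF x : U x -> differentiable F x.
  by move=> Ux; apply: differentiable_mx => i j; have [_ [/(_ _ Ux)]] := FC i j.
apply: Ck_differentiable => // v; apply: IHk => i j.
have [_ [_ /(_ v)]] := FC i j; apply: Ck_eq => x Ux.
by rewrite derive_mx_coord//; exact: dF.
Qed.

Lemma smooth_mx m n (F : V -> 'M[R]_(m, n)) :
  (forall i j, smooth_on U (fun x => F x i j)) -> smooth_on U F.
Proof. by move=> FC k; apply: Ck_mx => i j; exact: FC. Qed.

End SmoothCalculus.

Section SmoothPlane.
Context {R : realType}.
Variable U : set 'rV[R]_2.
Hypothesis openU : open U.

Lemma derive_plane {W : normedModType R} (f : 'rV[R]_2 -> W) (q v : 'rV[R]_2) :
  differentiable f q -> 'D_v f q = v 0 0 *: 'D_eu f q + v 0 1 *: 'D_ev f q.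
Proof.
move=> df; rewrite !deriveE// -!linearZ -linearD; congr ('d f q _).
by apply: plane_ext; rewrite !mxE /= ?mulr1 ?mulr0 ?addr0 ?add0r.
Qed.

(** Every directional derivative of [f] is a constant combination of [P] and [Q], so [f] is one
    order smoother than they are. *)
Lemma smooth_partials (f P Q : 'rV[R]_2 -> R) :
  (forall q, U q -> [/\ differentiable f q, 'D_eu f q = P q & 'D_ev f q = Q q]) ->
  smooth_on U P -> smooth_on U Q -> smooth_on U f.
Proof.
move=> fP sP sQ; suff f1 k : Ck k.+1 U f by move=> k; apply: CkS; exact: f1.
apply: Ck_differentiable => [q /fP[]//|v].
have C0 := @smooth_mul _ _ _ openU _ _ (@smooth_cst _ _ _ openU _ (v 0 0)) sP.
have C1 := @smooth_mul _ _ _ openU _ _ (@smooth_cst _ _ _ openU _ (v 0 1)) sQ.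
apply: (Ck_eq openU _ (smooth_add openU C0 C1 k)) => q Uq.
by have [df <- <-] := fP q Uq; rewrite [RHS]derive_plane.
Qed.

End SmoothPlane.

(** * Normal surfaces as solutions of a first-order system *)

Section FrameSystem.
Context {R : realType}.
Local Notation plane := 'rV[R]_2.
Local Notation H1 := 'rV[R]_3.
Implicit Types (p q : plane) (P v w : H1).

Definition has_partials (U : set plane) (f fu fv : plane -> R) : Prop :=
  forall q, U q -> [/\ differentiable f q, 'D_eu f q = fu q & 'D_ev f q = fv q].

(* With [(x, y, z)] the components of [F], the functions [X1] and [X2] are the
   coordinates of [F_u] in the frame [e1, e2]. *)
Definition frame_system (U : set plane) (a b c l m x y z X1 X2 : plane -> R) : Prop :=
  [/\ forall q, U q -> X1 q * X1 q + X2 q * X2 q = 1,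
      has_partials U X1 (fun q => - (l q * X2 q)) (fun q => - (m q * X2 q)) /\
      has_partials U X2 (fun q => l q * X1 q) (fun q => m q * X1 q),
      has_partials U x X1 (fun q => a q * X1 q - b q * X2 q),
      has_partials U y X2 (fun q => a q * X2 q + b q * X1 q)
    & has_partials U z (fun q => y q * X1 q - x q * X2 q)
        (fun q => c q + (y q * (a q * X1 q - b q * X2 q) -
                         x q * (a q * X2 q + b q * X1 q)))].

Lemma xcD v w : xc (v + w) = xc v + xc w. Proof. by rewrite /xc mxE. Qed.
Lemma ycD v w : yc (v + w) = yc v + yc w. Proof. by rewrite /yc mxE. Qed.
Lemma zcD v w : zc (v + w) = zc v + zc w. Proof. by rewrite /zc mxE. Qed.
Lemma xcZ (k : R) v : xc (k *: v) = k * xc v. Proof. by rewrite /xc mxE. Qed.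
Lemma ycZ (k : R) v : yc (k *: v) = k * yc v. Proof. by rewrite /yc mxE. Qed.
Lemma zcZ (k : R) v : zc (k *: v) = k * zc v. Proof. by rewrite /zc mxE. Qed.
Lemma xcN v : xc (- v) = - xc v. Proof. by rewrite /xc mxE. Qed.
Lemma ycN v : yc (- v) = - yc v. Proof. by rewrite /yc mxE. Qed.
Lemma zcN v : zc (- v) = - zc v. Proof. by rewrite /zc mxE. Qed.

Definition vecE := (xcD, ycD, zcD, xcZ, ycZ, zcZ, xcN, ycN, zcN, @vec3E R).

Lemma space_ext v w : xc v = xc w -> yc v = yc w -> zc v = zc w -> v = w.
Proof.
rewrite /xc /yc /zc => E0 E1 E2; apply/rowP => -[[|[|[|//]]] lti].
- by rewrite (_ : Ordinal lti = 0)//; exact: val_inj.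
- by rewrite (_ : Ordinal lti = 1)//; exact: val_inj.
- by rewrite (_ : Ordinal lti = 2)//; exact: val_inj.
Qed.

Lemma xcJ0 P w : xc (J0 P w) = - yc w.
Proof. by rewrite /J0 /e1 /e2 !vecE; ring. Qed.

Lemma ycJ0 P w : yc (J0 P w) = xc w.
Proof. by rewrite /J0 /e1 /e2 !vecE; ring. Qed.

Lemma zcJ0 P w : zc (J0 P w) = - (xc P * xc w + yc P * yc w).
Proof. by rewrite /J0 /e1 /e2 !vecE; ring. Qed.

Lemma theta0_J0 P w : theta0 P (J0 P w) = 0.
Proof. by rewrite /theta0 xcJ0 ycJ0 zcJ0; ring. Qed.

Lemma theta0_e3 P : theta0 P e3 = 1.
Proof. by rewrite /theta0 /e3 !vecE; ring. Qed.

Lemma theta0_lin P (j k : R) v w :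
  theta0 P (j *: v + k *: w) = j * theta0 P v + k * theta0 P w.
Proof. by rewrite /theta0 !vecE; ring. Qed.

Lemma theta0Z P (k : R) w : theta0 P (k *: w) = k * theta0 P w.
Proof. by rewrite /theta0 !vecE; ring. Qed.

Lemma inner_J0 P v w : inner P v (J0 P w) = yc v * xc w - xc v * yc w.
Proof. by rewrite /inner theta0_J0 xcJ0 ycJ0; ring. Qed.

Lemma inner_e3 P v : inner P v e3 = theta0 P v.
Proof. by rewrite /inner theta0_e3 /e3 !vecE; ring. Qed.

(** In the coordinates [xc] and [yc], the vectors [X] and [J0 P X] form an orthonormal basis of the
    plane. *)
Lemma tangent_coefficients P X v (a b : R) : theta0 P X = 0 ->
  xc X * xc X + yc X * yc X = 1 ->
  (a = inner P v X /\ b = inner P v (J0 P X)) <->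
  (xc v = a * xc X - b * yc X /\ yc v = a * yc X + b * xc X).
Proof.
rewrite inner_J0 /inner => -> u1; split=> -[-> ->].
- split; first by rewrite -[LHS]mulr1 -u1; ring.
  by rewrite -[LHS]mulr1 -u1; ring.
- split; first by rewrite -[LHS]mulr1 -u1; ring.
  by rewrite -[LHS]mulr1 -u1; ring.
Qed.

(** Meant for [w] a derivative of the unit field [X]: differentiating the norm gives the
    orthogonality, and the single number [k] then fixes both horizontal coordinates of [w]. *)
Lemma normal_coefficient P X w (k : R) : xc X * xc X + yc X * yc X = 1 ->
  (xc X * xc w + yc X * yc w = 0 /\ k = inner P w (J0 P X)) <->
  (xc w = - (k * yc X) /\ yc w = k * xc X).
Proof.
rewrite inner_J0 => u1; split=> [[u0 ->]|[-> ->]].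
- split.
    by rewrite -[RHS]addr0 -(mulr0 (xc X)) -u0 -[LHS]mulr1 -u1; ring.
  by rewrite -[RHS]addr0 -(mulr0 (yc X)) -u0 -[LHS]mulr1 -u1; ring.
- by split; [ring|rewrite -[LHS]mulr1 -u1; ring].
Qed.

Lemma zc_theta0 P w : zc w = theta0 P w + (yc P * xc w - xc P * yc w).
Proof. by rewrite /theta0; ring. Qed.

Lemma derive_xc {V : normedModType R} (F : V -> H1) (q v : V) :
  differentiable F q -> 'D_v (fun t => xc (F t)) q = xc ('D_v F q).
Proof. by move=> dF; rewrite {2}/xc derive_mx_coord. Qed.

Lemma derive_yc {V : normedModType R} (F : V -> H1) (q v : V) :
  differentiable F q -> 'D_v (fun t => yc (F t)) q = yc ('D_v F q).
Proof. by move=> dF; rewrite {2}/yc derive_mx_coord. Qed.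

Lemma derive_zc {V : normedModType R} (F : V -> H1) (q v : V) :
  differentiable F q -> 'D_v (fun t => zc (F t)) q = zc ('D_v F q).
Proof. by move=> dF; rewrite {2}/zc derive_mx_coord. Qed.

Lemma coord_comp {V W : Type} {m n : nat} (G : V -> 'M[W]_(m, n)) i j :
  (fun t => G t i j) = (fun M : 'M[W]_(m, n) => M i j) \o G.
Proof. by []. Qed.

Lemma differentiable_xyzc {V : normedModType R} (F : V -> H1) (q : V) :
  differentiable F q -> [/\ differentiable (fun t => xc (F t)) q,
    differentiable (fun t => yc (F t)) q & differentiable (fun t => zc (F t)) q].
Proof.
by move=> dF; split; rewrite /xc /yc /zc coord_comp;
  apply: differentiable_comp => //; exact: differentiable_coord.
Qed.

Lemma vec3_coordP {T : Type} (Q : (T -> R) -> Prop) (f g h : T -> R) :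
  Q f -> Q g -> Q h ->
  forall i j, Q (fun t => vec3 (f t) (g t) (h t) i j).
Proof.
move=> Qf Qg Qh i j; rewrite ord1.
have -> : (fun t => vec3 (f t) (g t) (h t) 0 j) =
    (fun t => [:: f t; g t; h t]`_j) by apply/funext => t; rewrite mxE.
by case: j => -[|[|[|//]]].
Qed.

Lemma differentiable_vec3 {V : normedModType R} (f g h : V -> R) (q : V) :
  differentiable f q -> differentiable g q -> differentiable h q ->
  differentiable (fun t => vec3 (f t) (g t) (h t)) q.
Proof.
move=> df dg dh; apply: differentiable_mx.
exact: (@vec3_coordP _ (fun f => differentiable f q)).
Qed.

Lemma derive_vec3 {V : normedModType R} (f g h : V -> R) (q v : V) :
  differentiable f q -> differentiable g q -> differentiable h q ->
  'D_v (fun t => vec3 (f t) (g t) (h t)) q = vec3 ('D_v f q) ('D_v g q) ('D_v h q).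
Proof.
move=> df dg dh; have dF := differentiable_vec3 df dg dh.
apply: space_ext; rewrite vec3E.
- by rewrite -derive_xc//; congr ('D_v _ q); apply/funext => t; rewrite vec3E.
- by rewrite -derive_yc//; congr ('D_v _ q); apply/funext => t; rewrite vec3E.
- by rewrite -derive_zc//; congr ('D_v _ q); apply/funext => t; rewrite vec3E.
Qed.

Lemma smooth_vec3 {V : normedModType R} (U : set V) (f g h : V -> R) : open U ->
  smooth_on U f -> smooth_on U g -> smooth_on U h ->
  smooth_on U (fun t => vec3 (f t) (g t) (h t)).
Proof.
move=> oU sf sg sh; apply: smooth_mx => //.
exact: (@vec3_coordP _ (fun f => smooth_on U f)).
Qed.

Lemma scaleRE (x y : R) : x *: (y : R) = x * y. Proof. by []. Qed.

Lemma derive_unit {V : normedModType R} (f g : V -> R) (q v : V) :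
  differentiable f q -> differentiable g q ->
  (\forall t \near q, f t * f t + g t * g t = 1) ->
  f q * 'D_v f q + g q * 'D_v g q = 0.
Proof.
move=> /(@diff_derivable _ _ _ _ _ v)/derivableP df.
move=> /(@diff_derivable _ _ _ _ _ v)/derivableP dg.
move=> /(near_eq_derive v); rewrite derive_cst.
rewrite (@derive_val _ _ _ _ _ _ _ (is_deriveD (is_deriveM df df) (is_deriveM dg dg))).
by rewrite !scaleRE; lra.
Qed.

Section OnU.
Variables (U : set plane) (a b c l m : plane -> R).
Hypothesis openU : open U.

(** All geometric conditions but the unit norm follow from [theta0 ('d F q v) = v 0 1 * c q]: as [c]
    has no zeros, a tangent vector is in the contact plane only when it comes from the
    [u]-direction. *)
Lemma frame_system_surface x y z X1 X2 :
  smooth_on U x -> smooth_on U y -> smooth_on U z ->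
  (forall q, U q -> c q != 0) -> frame_system U a b c l m x y z X1 X2 ->
  let F q := vec3 (x q) (y q) (z q) in
  normal_surface U F /\ has_coefficients U F a b c l m.
Proof.
move=> sx sy sz c_neq0 [unit [X1P X2P] xP yP zP] F.
have sF : smooth_on U F by exact: smooth_vec3.
have dF q : U q -> differentiable F q by exact: smooth_differentiable.
have FE (v : plane) q : U q -> 'D_v F q = vec3 ('D_v x q) ('D_v y q) ('D_v z q).
  move=> Uq; apply: derive_vec3.
  - by have [] := xP q Uq.
  - by have [] := yP q Uq.
  - by have [] := zP q Uq.
have Fu q : U q -> 'D_eu F q = vec3 (X1 q) (X2 q) (y q * X1 q - x q * X2 q).
  by move=> Uq; rewrite FE//; have [_ -> _] := xP q Uq; have [_ -> _] := yP q Uq;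
    have [_ -> _] := zP q Uq.
have Fv q : U q -> 'D_ev F q = vec3 (a q * X1 q - b q * X2 q)
    (a q * X2 q + b q * X1 q) (c q + (y q * (a q * X1 q - b q * X2 q) -
                         x q * (a q * X2 q + b q * X1 q))).
  by move=> Uq; rewrite FE//; have [_ _ ->] := xP q Uq; have [_ _ ->] := yP q Uq;
    have [_ _ ->] := zP q Uq.
(* The third component is left unnamed, since the coefficients of the second kind do not see it. *)
have Fuw (v : plane) q : U q ->
    exists w : R, 'D_v ('D_eu F) q = vec3 ('D_v X1 q) ('D_v X2 q) w.
  move=> Uq; exists ('D_v (fun q => y q * X1 q - x q * X2 q) q).
  have [dX1 _ _] := X1P q Uq; have [dX2 _ _] := X2P q Uq.
  have [dx _ _] := xP q Uq; have [dy _ _] := yP q Uq.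
  rewrite -derive_vec3//.
    by apply: near_eq_derive; exact: (near_open openU Fu).
  by apply: differentiableB; exact: differentiableM.
have thu q : U q -> theta0 (F q) ('D_eu F q) = 0.
  by move=> Uq; rewrite Fu// /theta0 /F !vecE; ring.
have thv q : U q -> theta0 (F q) ('D_ev F q) = c q.
  by move=> Uq; rewrite Fv// /theta0 /F !vecE; ring.
clearbody F.
have Xu q : U q -> xc ('D_eu F q) = X1 q by move=> Uq; rewrite (Fu q Uq) vec3E.
have Yu q : U q -> yc ('D_eu F q) = X2 q by move=> Uq; rewrite (Fu q Uq) vec3E.
have Xv q : U q -> xc ('D_ev F q) = a q * X1 q - b q * X2 q.
  by move=> Uq; rewrite (Fv q Uq) vec3E.
have Yv q : U q -> yc ('D_ev F q) = a q * X2 q + b q * X1 q.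
  by move=> Uq; rewrite (Fv q Uq) vec3E.
have unitF q : U q ->
    xc ('D_eu F q) * xc ('D_eu F q) + yc ('D_eu F q) * yc ('D_eu F q) = 1.
  by move=> Uq; rewrite Xu// Yu//; exact: unit.
have thd q (v : plane) : U q -> theta0 (F q) ('d F q v) = v 0 1 * c q.
  move=> Uq; have := derive_plane v (dF q Uq); rewrite (deriveE _ (dF q Uq)) => ->.
  by rewrite -(thv q Uq) -[RHS]add0r -(mulr0 (v 0 0)) -(thu q Uq); exact: theta0_lin.
have dFE q (v : plane) : U q -> v 0 1 = 0 -> 'd F q v = v 0 0 *: 'D_eu F q.
  move=> Uq v1; have := derive_plane v (dF q Uq).
  by rewrite (deriveE _ (dF q Uq)) v1 scale0r addr0.
split; first split.
- exact: sF.
- move=> q Uq v w E; apply/subr0_eq; move/eqP: E; rewrite -subr_eq0 -linearB.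
  move: (v - w) => {v w} s /eqP s0.
  have s1 : s 0 1 = 0.
    have := thd q s Uq; rewrite s0 /theta0 /xc /yc /zc !mxE !mulr0 subr0 addr0.
    by move=> /esym/eqP; rewrite mulf_eq0 (negbTE (c_neq0 _ Uq)) orbF => /eqP.
  move: s0; rewrite (dFE q s Uq s1) => s0.
  have := etrans (esym (xcZ _ _)) (congr1 xc s0).
  have := etrans (esym (ycZ _ _)) (congr1 yc s0).
  rewrite (Xu q Uq) (Yu q Uq) /xc /yc !mxE => s02 s01; apply: plane_ext; rewrite mxE//.
  by rewrite -[LHS]mulr1 -(unit q Uq) mulrDr !mulrA s01 s02 !mul0r addr0.
- move=> q Uq E; have : tangent_plane F q ('D_ev F q).
    by exists ev => //; rewrite deriveE//; exact: dF.
  by rewrite E /contact_plane /= (thv q Uq); apply/eqP/c_neq0.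
- move=> q Uq; apply/seteqP; split=> [_ [[v _ <-]]|_ [k ->]].
    rewrite /contact_plane /= (thd q v Uq) => /eqP.
    rewrite mulf_eq0 (negbTE (c_neq0 _ Uq)) orbF => /eqP v1.
    by exists (v 0 0); exact: dFE.
  split; first by exists (k *: eu) => //; rewrite linearZ /= -deriveE//; exact: dF.
  rewrite /contact_plane /=; apply: etrans (theta0Z _ _ _) _.
  by rewrite (thu q Uq) mulr0.
- move=> q Uq; rewrite /hnorm /inner (thu q Uq) mulr0 addr0 (unitF q Uq).
  exact: sqrtr1.
- move=> q Uq /=.
  have [|aE bE] := (tangent_coefficients ('D_ev F q) (a q) (b q)
    (thu q Uq) (unitF q Uq)).2.
    by have := Xv q Uq; have := Yv q Uq; rewrite -(Xu q Uq) -(Yu q Uq); split.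
  have [|_ lE] := (normal_coefficient (F q) ('D_eu ('D_eu F) q) (l q)
    (unitF q Uq)).2.
    have [wu ->] := Fuw eu q Uq; rewrite (Xu q Uq) (Yu q Uq) !vec3E.
    by have [_ -> _] := X1P q Uq; have [_ -> _] := X2P q Uq.
  have [|_ mE] := (normal_coefficient (F q) ('D_ev ('D_eu F) q) (m q)
    (unitF q Uq)).2.
    have [wv ->] := Fuw ev q Uq; rewrite (Xu q Uq) (Yu q Uq) !vec3E.
    by have [_ _ ->] := X1P q Uq; have [_ _ ->] := X2P q Uq.
  by split; [exact: aE|exact: bE|rewrite inner_e3 (thv q Uq)|exact: lE|exact: mE].
Qed.

(** The foliation condition makes F_u horizontal, so its norm involves only [xc] and [yc];
    differentiating the unit norm supplies the orthogonality that [normal_coefficient] asks for. *)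
Lemma surface_frame_system F : normal_surface U F -> has_coefficients U F a b c l m ->
  frame_system U a b c l m (xc \o F) (yc \o F) (zc \o F)
    (fun q => xc ('D_eu F q)) (fun q => yc ('D_eu F q)).
Proof.
move=> [sF _ _ folF normF] coefF.
have dF q : U q -> differentiable F q by exact: smooth_differentiable.
have dFu q : U q -> differentiable ('D_eu F) q.
  by apply: smooth_differentiable; exact: smooth_derive.
have thu q : U q -> theta0 (F q) ('D_eu F q) = 0.
  move=> Uq; have : (tangent_plane F q `&` contact_plane (F q)) ('D_eu F q).
    by rewrite folF//; exists 1; rewrite scale1r.
  by case.
have unit q : U q -> xc ('D_eu F q) * xc ('D_eu F q) +
    yc ('D_eu F q) * yc ('D_eu F q) = 1.
  move=> Uq; have := normF q Uq; rewrite /hnorm /inner (thu q Uq) mulr0 addr0.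
  move=> /(congr1 (fun x => x ^+ 2)); rewrite sqr_sqrtr ?expr1n//.
  by rewrite addr_ge0 // -expr2 sqr_ge0.
have X1v q (v : plane) : U q ->
    'D_v (fun t => xc ('D_eu F t)) q = xc ('D_v ('D_eu F) q).
  by move=> Uq; rewrite derive_xc//; exact: dFu.
have X2v q (v : plane) : U q ->
    'D_v (fun t => yc ('D_eu F t)) q = yc ('D_v ('D_eu F) q).
  by move=> Uq; rewrite derive_yc//; exact: dFu.
have orth q (v : plane) : U q -> xc ('D_eu F q) * xc ('D_v ('D_eu F) q) +
    yc ('D_eu F q) * yc ('D_v ('D_eu F) q) = 0.
  move=> Uq; rewrite -(X1v q v Uq) -(X2v q v Uq).
  have [d1 d2 _] := differentiable_xyzc (dFu q Uq).
  exact: (derive_unit v d1 d2 (filterS unit (open_nbhs_nbhs (conj openU Uq)))).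
have tan q : U q -> xc ('D_ev F q) = a q * xc ('D_eu F q) - b q * yc ('D_eu F q) /\
    yc ('D_ev F q) = a q * yc ('D_eu F q) + b q * xc ('D_eu F q).
  move=> Uq; have [aE bE _ _ _] := coefF q Uq.
  exact: ((tangent_coefficients _ _ _ (thu q Uq) (unit q Uq)).1 (conj aE bE)).
have nor q (v : plane) k : U q ->
    k = inner (F q) ('D_v ('D_eu F) q) (J0 (F q) ('D_eu F q)) ->
    xc ('D_v ('D_eu F) q) = - (k * yc ('D_eu F q)) /\
    yc ('D_v ('D_eu F) q) = k * xc ('D_eu F q).
  move=> Uq kE.
  exact: ((normal_coefficient _ _ _ (unit q Uq)).1 (conj (orth q v Uq) kE)).
split=> //.
- split=> q Uq; have [dX1 dX2 _] := differentiable_xyzc (dFu q Uq).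
    have [_ _ _ lE mE] := coefF q Uq; split=> //.
      by rewrite (X1v q eu Uq); exact: (nor q eu _ Uq lE).1.
    by rewrite (X1v q ev Uq); exact: (nor q ev _ Uq mE).1.
  have [_ _ _ lE mE] := coefF q Uq; split=> //.
    by rewrite (X2v q eu Uq); exact: (nor q eu _ Uq lE).2.
  by rewrite (X2v q ev Uq); exact: (nor q ev _ Uq mE).2.
- move=> q Uq; have [dx _ _] := differentiable_xyzc (dF q Uq).
  split; [exact: dx|exact: derive_xc (dF q Uq)|].
  have h1 : 'D_ev (xc \o F) q = xc ('D_ev F q) by exact: derive_xc (dF q Uq).
  by rewrite h1; exact: (tan q Uq).1.
- move=> q Uq; have [_ dy _] := differentiable_xyzc (dF q Uq).
  split; [exact: dy|exact: derive_yc (dF q Uq)|].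
  have h1 : 'D_ev (yc \o F) q = yc ('D_ev F q) by exact: derive_yc (dF q Uq).
  by rewrite h1; exact: (tan q Uq).2.
- move=> q Uq; have [_ _ dz] := differentiable_xyzc (dF q Uq).
  have [_ _ cE _ _] := coefF q Uq; rewrite inner_e3 in cE.
  split; first exact: dz.
    have h1 : 'D_eu (zc \o F) q = zc ('D_eu F q) by exact: derive_zc (dF q Uq).
    rewrite h1; apply: etrans (zc_theta0 (F q) _) _.
    by rewrite (thu q Uq) add0r.
  have h1 : 'D_ev (zc \o F) q = zc ('D_ev F q) by exact: derive_zc (dF q Uq).
  rewrite h1; apply: etrans (zc_theta0 (F q) _) _.
  have [t1 t2] := tan q Uq.
  exact: (f_equal2 +%R (esym cE)
    (f_equal2 (fun s t : R => yc (F q) * s - xc (F q) * t) t1 t2)).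
Qed.

End OnU.
End FrameSystem.

(** * Existence and rigid motions *)

Section Existence.
Context {R : realType}.
Local Notation plane := 'rV[R]_2.
Variable U : set plane.
Hypothesis openU : open U.

Lemma smooth_has_partials (f : plane -> R) :
  smooth_on U f -> has_partials U f ('D_eu f) ('D_ev f).
Proof. by move=> sf q Uq; split=> //; exact: smooth_differentiable Uq. Qed.

Lemma has_partialsM (f fu fv g gu gv : plane -> R) :
  has_partials U f fu fv -> has_partials U g gu gv ->
  has_partials U (fun q => f q * g q) (fun q => fu q * g q + f q * gu q)
    (fun q => fv q * g q + f q * gv q).
Proof.
move=> fP gP q Uq; have [df <- <-] := fP q Uq; have [dg <- <-] := gP q Uq.
split; first exact: differentiableM.
all: rewrite -[LHS]/(derive (f * g) q _) deriveM; try exact: diff_derivable.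
all: by rewrite !scaleRE; ring.
Qed.

Lemma has_partialsD (f fu fv g gu gv : plane -> R) :
  has_partials U f fu fv -> has_partials U g gu gv ->
  has_partials U (fun q => f q + g q) (fun q => fu q + gu q)
    (fun q => fv q + gv q).
Proof.
move=> fP gP q Uq; have [df <- <-] := fP q Uq; have [dg <- <-] := gP q Uq.
split; first exact: differentiableD.
all: by rewrite -[LHS]/(derive (f + g) q _) deriveD//; exact: diff_derivable.
Qed.

Lemma has_partialsB (f fu fv g gu gv : plane -> R) :
  has_partials U f fu fv -> has_partials U g gu gv ->
  has_partials U (fun q => f q - g q) (fun q => fu q - gu q)
    (fun q => fv q - gv q).
Proof.
move=> fP gP q Uq; have [df <- <-] := fP q Uq; have [dg <- <-] := gP q Uq.
split; first exact: differentiableB.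
all: by rewrite -[LHS]/(derive (f - g) q _) deriveB//; exact: diff_derivable.
Qed.

Lemma has_partials_comp (g dg : R -> R) (f fu fv : plane -> R) :
  (forall t : R, is_derive t 1 g (dg t)) -> has_partials U f fu fv ->
  has_partials U (g \o f) (fun q => fu q * dg (f q)) (fun q => fv q * dg (f q)).
Proof.
move=> gD fP q Uq; have [df <- <-] := fP q Uq.
by split; [have [] := is_derive_comp_real 0 (gD (f q)) df|
  exact: (is_derive_comp_real _ (gD (f q)) df).2..].
Qed.

Lemma smooth_primitive (P Q : plane -> R) : simply_connected U ->
  smooth_on U P -> smooth_on U Q -> (forall q, U q -> 'D_ev P q = 'D_eu Q q) ->
  exists2 f : plane -> R, smooth_on U f & has_partials U f P Q.
Proof.
move=> scU sP sQ PQ.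
have [|f fP] := closed_form_exact openU (smooth_differentiable sP)
  (smooth_differentiable sQ) PQ _ scU.
  by move=> q Uq; have [/(_ _ Uq)] := smooth_derive ev sP 0%N.
by exists f => //; exact: smooth_partials sP sQ.
Qed.

Lemma frame_system_exists (a b c l m : plane -> R) : simply_connected U ->
  smooth_on U a -> smooth_on U b -> smooth_on U c ->
  smooth_on U l -> smooth_on U m -> integrability_conditions U a b c l m ->
  exists x y z X1 X2 : plane -> R,
    [/\ smooth_on U x, smooth_on U y, smooth_on U z
      & frame_system U a b c l m x y z X1 X2].
Proof.
move=> scU sa sb sc sl sm integrable.
have [|phi sphi phiP] := smooth_primitive scU sl sm.
  by move=> q Uq; have [_ _ _ /eqP] := integrable q Uq; rewrite subr_eq0 => /eqP.
(* [phi] is the primitive of l du + m dv, which is closed since l_v = m_u. *)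
pose X1 := cos \o phi; pose X2 := sin \o phi.
have sX1 : smooth_on U X1 by exact: smooth_cos.
have sX2 : smooth_on U X2 by exact: smooth_sin.
have X1P : has_partials U X1 (fun q => l q * - X2 q) (fun q => m q * - X2 q).
  exact: (has_partials_comp (@is_derive_cos R) phiP).
have X2P : has_partials U X2 (fun q => l q * X1 q) (fun q => m q * X1 q).
  exact: (has_partials_comp (@is_derive_sin R) phiP).
have aP := smooth_has_partials sa; have bP := smooth_has_partials sb.
have cP := smooth_has_partials sc.
have sxv : smooth_on U (fun q => a q * X1 q - b q * X2 q).
  by apply: smooth_sub => //; exact: smooth_mul.
have syv : smooth_on U (fun q => a q * X2 q + b q * X1 q).
  by apply: smooth_add => //; exact: smooth_mul.
have xvP := has_partialsB (has_partialsM aP X1P) (has_partialsM bP X2P).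
have yvP := has_partialsD (has_partialsM aP X2P) (has_partialsM bP X1P).
(* Closedness for [x], and likewise for [y] below, comes from the conditions on a_u and b_u. *)
have [|x sx xP] := smooth_primitive scU sX1 sxv.
  move=> q Uq; have [_ _ ->] := X1P q Uq; have [_ -> _] := xvP q Uq.
  by have [-> -> _ _] := integrable q Uq; ring.
have [|y sy yP] := smooth_primitive scU sX2 syv.
  move=> q Uq; have [_ _ ->] := X2P q Uq; have [_ -> _] := yvP q Uq.
  by have [-> -> _ _] := integrable q Uq; ring.
have unit q : X1 q * X1 q + X2 q * X2 q = 1.
  by rewrite -!expr2 cos2Dsin2.
have zuP := has_partialsB (has_partialsM yP X1P) (has_partialsM xP X2P).
have zvP := has_partialsD cP
  (has_partialsB (has_partialsM yP xvP) (has_partialsM xP yvP)).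
have szu := smooth_sub openU (smooth_mul openU sy sX1) (smooth_mul openU sx sX2).
have szv := smooth_add openU sc
  (smooth_sub openU (smooth_mul openU sy sxv) (smooth_mul openU sx syv)).
have [|z sz zP] := smooth_primitive scU szu szv.
  move=> q Uq; have [_ _ ->] := zuP q Uq; have [_ -> _] := zvP q Uq.
  have [-> -> -> _] := integrable q Uq.
  (* Equality of the mixed derivatives of [z] requires c_u = 2 b (X1^2 + X2^2); restoring the unit
     factor makes it a polynomial identity. *)
  rewrite [2 * b q](_ : _ = 2 * (b q * (X1 q * X1 q + X2 q * X2 q))); first by ring.
  by rewrite unit mulr1.
exists x, y, z, X1, X2; split=> //; split=> //.
by split=> // q Uq; have [dX ->  ->] := X1P q Uq; rewrite !mulrN.
Qed.

End Existence.

Section RigidMotion.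
Context {R : realType}.
Local Notation H1 := 'rV[R]_3.

(* The rotation with cosine [al] and sine [be] about the z-axis, followed by
   the left translation by [(x0, y0, z0)]. *)
Definition rigid (al be x0 y0 z0 : R) (P : H1) : H1 :=
  let x := al * xc P - be * yc P in
  let y := be * xc P + al * yc P in
  vec3 (x + x0) (y + y0) (zc P + z0 + (y0 * x - x0 * y)).

(** The rotation is a group automorphism fixing the z-axis, so the inverse map rotates back and then
    translates by the rotated-back inverse of [(x0, y0, z0)]. *)
Lemma rigidK (al be x0 y0 z0 : R) : al * al + be * be = 1 ->
  cancel (rigid al be x0 y0 z0)
    (rigid al (- be) (- (al * x0 + be * y0)) (be * x0 - al * y0) (- z0)).
Proof.
move=> u1 P; apply: space_ext; rewrite /rigid !vecE.
- by rewrite -[RHS]mul1r -u1; ring.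
- by rewrite -[RHS]mul1r -u1; ring.
- set x := al * xc P - be * yc P; set y := be * xc P + al * yc P.
  transitivity (zc P + (y0 * x - x0 * y) * (1 - (al * al + be * be))); first by ring.
  by rewrite u1; ring.
Qed.

Lemma rigidVK (al be x0 y0 z0 : R) : al * al + be * be = 1 ->
  cancel (rigid al (- be) (- (al * x0 + be * y0)) (be * x0 - al * y0) (- z0))
    (rigid al be x0 y0 z0).
Proof.
move=> u1; have u1' : al * al + - be * - be = 1 by rewrite mulrNN.
have := @rigidK al (- be) (- (al * x0 + be * y0)) (be * x0 - al * y0) (- z0) u1'.
rewrite !opprK; congr (cancel _ (rigid _ _ _ _ _)).
- by rewrite -[RHS]mul1r -u1; ring.
- by rewrite -[RHS]mul1r -u1; ring.
Qed.

Lemma smooth_coord : [/\ smooth_on setT (@xc R), smooth_on setT (@yc R)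
  & smooth_on setT (@zc R)].
Proof.
suff H (i : 'I_3) : smooth_on setT (fun P : H1 => P 0 i) by split; exact: H.
case=> [|k]; first by split=> // P _; exact: coord_continuous.
apply: Ck_differentiable => [P _|v]; first exact: differentiable_coord.
apply: (Ck_eq openT _ (smooth_cst openT (v 0 i) k)) => P _.
by rewrite (@derive_val _ _ _ _ _ _ _ (is_derive_coord 0 i P v)).
Qed.

Lemma smooth_rigid (al be x0 y0 z0 : R) : smooth_on setT (rigid al be x0 y0 z0).
Proof.
have [sx sy sz] := smooth_coord; have sc (k : R) := smooth_cst (@openT H1) k.
have sM (k : R) f : smooth_on setT f -> smooth_on setT (fun P : H1 => k * f P).
  exact: (smooth_mul openT (sc k)).
have sX := smooth_sub openT (sM al _ sx) (sM be _ sy).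
have sY := smooth_add openT (sM be _ sx) (sM al _ sy).
apply: smooth_vec3; first exact: openT.
- exact: (smooth_add openT sX (sc x0)).
- exact: (smooth_add openT sY (sc y0)).
- exact: (smooth_add openT (smooth_add openT sz (sc z0))
    (smooth_sub openT (sM y0 _ sX) (sM x0 _ sY))).
Qed.

(** The map is affine in the coordinates, so its differential is its linear part at every point. *)
Lemma diff_rigid (al be x0 y0 z0 : R) (P w : H1) :
  'd (rigid al be x0 y0 z0) P w =
  vec3 (al * xc w - be * yc w) (be * xc w + al * yc w)
    (zc w + (y0 * (al * xc w - be * yc w) - x0 * (be * xc w + al * yc w))).
Proof.
have dr := smooth_differentiable (smooth_rigid al be x0 y0 z0) I.
rewrite -deriveE; last exact: dr.
have Dx : is_derive P w (@xc R) (xc w) := is_derive_coord 0 0 P w.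
have Dy : is_derive P w (@yc R) (yc w) := is_derive_coord 0 1 P w.
have Dz : is_derive P w (@zc R) (zc w) := is_derive_coord 0 2 P w.
have DX := is_deriveB (is_deriveZ al Dx) (is_deriveZ be Dy).
have DY := is_deriveD (is_deriveZ be Dx) (is_deriveZ al Dy).
have D0 (k : R) := is_derive_cst k P w.
have DZ := is_deriveD (is_deriveD Dz (D0 z0))
  (is_deriveB (is_deriveZ y0 DX) (is_deriveZ x0 DY)).
have DX0 := is_deriveD DX (D0 x0); have DY0 := is_deriveD DY (D0 y0).
have drP := dr P.
apply: space_ext; rewrite vec3E.
- rewrite -(derive_xc w drP).
  have -> : (fun t => xc (rigid al be x0 y0 z0 t)) =
      ((al \*: @xc R) - (be \*: @yc R)) + cst x0.
    by apply/funext => t; rewrite /rigid vec3E.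
  by rewrite (@derive_val _ _ _ _ _ _ _ DX0) addr0.
- rewrite -(derive_yc w drP).
  have -> : (fun t => yc (rigid al be x0 y0 z0 t)) =
      ((be \*: @xc R) + (al \*: @yc R)) + cst y0.
    by apply/funext => t; rewrite /rigid vec3E.
  by rewrite (@derive_val _ _ _ _ _ _ _ DY0) addr0.
- rewrite -(derive_zc w drP).
  have -> : (fun t => zc (rigid al be x0 y0 z0 t)) =
      (@zc R + cst z0) + ((y0 \*: ((al \*: @xc R) - (be \*: @yc R))) -
        (x0 \*: ((be \*: @xc R) + (al \*: @yc R)))).
    by apply/funext => t; rewrite /rigid vec3E.
  by rewrite (@derive_val _ _ _ _ _ _ _ DZ) addr0.
Qed.

(** For [theta0]: the rotation preserves x dy - y dx, and the shear in the third coordinate cancels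
    what the translation adds. *)
Lemma PSH1_rigid (al be x0 y0 z0 : R) : al * al + be * be = 1 ->
  PSH1 (rigid al be x0 y0 z0).
Proof.
move=> u1; split.
- exact: smooth_rigid.
- exists (rigid al (- be) (- (al * x0 + be * y0)) (be * x0 - al * y0) (- z0)).
  by split; [exact: smooth_rigid|exact: rigidK|exact: rigidVK].
- move=> P w; rewrite diff_rigid /theta0 /rigid !vecE.
  transitivity (zc w + (al * al + be * be) * (xc P * yc w - yc P * xc w)).
    by ring.
  by rewrite u1; ring.
- move=> P w _; rewrite !diff_rigid; apply: space_ext.
  + by rewrite [RHS]xcJ0 !vec3E xcJ0 ycJ0; ring.
  + by rewrite [RHS]ycJ0 !vec3E xcJ0 ycJ0; ring.
  + rewrite [RHS]zcJ0 /rigid !vec3E xcJ0 ycJ0 zcJ0.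
    transitivity (- (al * al + be * be) * (xc P * xc w + yc P * yc w)
      + (y0 * (- al * yc w - be * xc w) - x0 * (- be * yc w + al * xc w))).
      by rewrite u1; ring.
    by ring.
Qed.

End RigidMotion.

(** * Uniqueness *)

Section Uniqueness.
Context {R : realType}.
Local Notation plane := 'rV[R]_2.
Variable U : set plane.
Hypotheses (openU : open U) (pcU : path_connected U).

(** Vary one coordinate at a time; the corner [pt (q 0 0) (p 0 1)] lies in the ball because the ball
    is a square. *)
Lemma has_partials0_ball (f fu fv : plane -> R) (p q : plane) (e : R) :
  has_partials U f fu fv -> (forall q, U q -> fu q = 0) ->
  (forall q, U q -> fv q = 0) -> ball p e `<=` U -> ball p e q -> f p = f q.
Proof.
move=> fP fu0 fv0 pU pq; have [pq0 pq1] := (ball_planeP _ _ _).1 pq.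
have e0 : 0 < e by case: pq.
have p0 : ball (p 0 0) e (p 0 0) by exact: ballxx.
have p1 : ball (p 0 1) e (p 0 1) by exact: ballxx.
rewrite -[p]ptK -[q]ptK; transitivity (f (pt (q 0 0) (p 0 1))).
- apply: (@eq_is_derive0 _ (p 0 0) e (fun u => f (pt u (p 0 1)))) => // u pu.
  have Uu : U (pt u (p 0 1)) by exact/pU/ball_pt.
  by have [df fuE _] := fP _ Uu; rewrite -(fu0 _ Uu) -fuE; exact: is_derive_pt1.
- apply: (@eq_is_derive0 _ (p 0 1) e (fun v => f (pt (q 0 0) v))) => // v pv.
  have Uv : U (pt (q 0 0) v) by exact/pU/ball_pt.
  by have [df _ fvE] := fP _ Uv; rewrite -(fv0 _ Uv) -fvE; exact: is_derive_pt2.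
Qed.

Lemma has_partials0_cst (f fu fv : plane -> R) :
  has_partials U f fu fv -> (forall q, U q -> fu q = 0) ->
  (forall q, U q -> fv q = 0) -> forall p q, U p -> U q -> f p = f q.
Proof.
move=> fP fu0 fv0 p q Up Uq; have [g [gc gU <- <-]] := pcU Up Uq.
have cI := @segment_compact R 0 1.
have [e e0 eU] := compact_image_thickening cI gc openU gU.
have [d d0 dg] := compact_uniform_continuous cI gc e0.
near \oo => n.
have n0 : (0 < n)%N by near: n; exact: nbhs_infty_gt.
have H k : (k <= n)%N -> f (g 0) = f (g (k%:R / n%:R)).
  elim: k => [|k IHk] kn; first by rewrite mul0r.
  rewrite IHk; last exact: ltnW.
  have Ik := @unit_fraction R k n (ltnW kn) n0.
  apply: (has_partials0_ball fP fu0 fv0 (eU _ Ik)).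
  apply: dg => //; first exact: unit_fraction.
  rewrite -ball_normE /= -mulrBl -natr1 opprD addrA subrr add0r mulN1r normrN.
  by rewrite ger0_norm ?invr_ge0//; near: n; exact: near_inv_lt.
by rewrite (H n)// divff// pnatr_eq0 -lt0n.
Unshelve. all: by end_near. Qed.

(** Each parameter of the motion is an expression in the two solutions whose partial derivatives
    vanish, evaluated at [q0]. *)
Lemma frame_system_unique (a b c l m x y z X1 X2 x' y' z' X1' X2' : plane -> R) q0 :
  U q0 -> frame_system U a b c l m x y z X1 X2 ->
  frame_system U a b c l m x' y' z' X1' X2' ->
  exists al be x0 y0 z0 : R, al * al + be * be = 1 /\
    forall q, U q -> vec3 (x' q) (y' q) (z' q) =
      rigid al be x0 y0 z0 (vec3 (x q) (y q) (z q)).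
Proof.
(* [al] and [be] below are the cosine and sine of the angle from [(X1, X2)] to [(X1', X2')]. Both
   unit fields turn at the same rates [l] and [m], so this angle is constant. *)
move=> Uq0 [u1 [X1P X2P] xP yP zP] [u1' [X1P' X2P'] xP' yP' zP'].
pose al := X1 q0 * X1' q0 + X2 q0 * X2' q0.
pose be := X1 q0 * X2' q0 - X2 q0 * X1' q0.
have alE q : U q -> X1 q * X1' q + X2 q * X2' q = al.
  move=> Uq; have := has_partialsD (has_partialsM X1P X1P') (has_partialsM X2P X2P').
  by move=> /has_partials0_cst; apply=> // t _; ring.
have beE q : U q -> X1 q * X2' q - X2 q * X1' q = be.
  move=> Uq; have := has_partialsB (has_partialsM X1P X2P') (has_partialsM X2P X1P').
  by move=> /has_partials0_cst; apply=> // t _; ring.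
have X1E q : U q -> X1' q = al * X1 q - be * X2 q.
  by move=> Uq; rewrite -(alE q Uq) -(beE q Uq) -[LHS]mulr1 -(u1 q Uq); ring.
have X2E q : U q -> X2' q = be * X1 q + al * X2 q.
  by move=> Uq; rewrite -(alE q Uq) -(beE q Uq) -[LHS]mulr1 -(u1 q Uq); ring.
have cst0 (k : R) : has_partials U (fun=> k) (fun=> 0) (fun=> 0).
  by move=> q Uq; split; [exact: differentiable_cst|exact: derive_cst..].
have XP := has_partialsB (has_partialsM (cst0 al) xP) (has_partialsM (cst0 be) yP).
have YP := has_partialsD (has_partialsM (cst0 be) xP) (has_partialsM (cst0 al) yP).
pose x0 := x' q0 - (al * x q0 - be * y q0).
pose y0 := y' q0 - (be * x q0 + al * y q0).
have xE q : U q -> x' q - (al * x q - be * y q) = x0.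
  move=> Uq; have := has_partialsB xP' XP.
  by move=> /has_partials0_cst; apply=> // t Ut; rewrite ?X1E// ?X2E//; ring.
have yE q : U q -> y' q - (be * x q + al * y q) = y0.
  move=> Uq; have := has_partialsB yP' YP.
  by move=> /has_partials0_cst; apply=> // t Ut; rewrite ?X1E// ?X2E//; ring.
(* The shear that left translation by [(x0, y0, z0)] adds to the third coordinate. *)
pose z1 q := y0 * (al * x q - be * y q) - x0 * (be * x q + al * y q).
pose z0 := z' q0 - (z q0 + z1 q0).
have ab1 : al * al + be * be = 1.
  (* The two-square identity of Brahmagupta and Lagrange. *)
  transitivity ((X1 q0 * X1 q0 + X2 q0 * X2 q0) * (X1' q0 * X1' q0 + X2' q0 * X2' q0)).
    by rewrite /al /be; ring.
  by rewrite u1// u1'// mulr1.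
have zE q : U q -> z' q - (z q + z1 q) = z0.
  move=> Uq; have := has_partialsB zP' (has_partialsD zP
    (has_partialsB (has_partialsM (cst0 y0) XP) (has_partialsM (cst0 x0) YP))).
  have x'E t : U t -> x' t = x0 + (al * x t - be * y t)
    by move=> Ut; rewrite -(xE t Ut) subrK.
  have y'E t : U t -> y' t = y0 + (be * x t + al * y t)
    by move=> Ut; rewrite -(yE t Ut) subrK.
  move=> /has_partials0_cst; apply=> // t Ut;
    rewrite (X1E t Ut) (X2E t Ut) (x'E t Ut) (y'E t Ut).
  (* The translation terms cancel against [z1]; what remains is the change of y dx - x dy under the
     rotation. *)
  - transitivity ((al * al + be * be - 1) * (y t * X1 t - x t * X2 t)); first by ring.
    by rewrite ab1 subrr mul0r.
  - transitivity ((al * al + be * be - 1) * (y t * (a t * X1 t - b t * X2 t) -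
      x t * (a t * X2 t + b t * X1 t))); first by ring.
    by rewrite ab1 subrr mul0r.
exists al, be, x0, y0, z0; split=> // q Uq.
rewrite /rigid !vec3E; congr vec3.
- by rewrite -(xE q Uq) addrC subrK.
- by rewrite -(yE q Uq) addrC subrK.
- by rewrite -(zE q Uq) /z1; ring.
Qed.

End Uniqueness.

Theorem theorem1p8 (R : realType) (U : set 'rV[R]_2)
    (a b c l m : 'rV[R]_2 -> R)
    (openU : open U) (scU : simply_connected U)
    (smooth_a : smooth_on U a) (smooth_b : smooth_on U b)
    (smooth_c : smooth_on U c) (smooth_l : smooth_on U l)
    (smooth_m : smooth_on U m)
    (c_neq0 : forall q, U q -> c q != 0)
    (integrable : integrability_conditions U a b c l m) :
  (exists F : 'rV[R]_2 -> 'rV[R]_3,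
      normal_surface U F /\ has_coefficients U F a b c l m) /\
  (forall F F' : 'rV[R]_2 -> 'rV[R]_3,
      normal_surface U F -> has_coefficients U F a b c l m ->
      normal_surface U F' -> has_coefficients U F' a b c l m ->
      exists g : 'rV[R]_3 -> 'rV[R]_3,
        PSH1 g /\ forall q, U q -> F' q = g (F q)).
Proof.
split.
  have [x [y [z [X1 [X2 [sx sy sz sys]]]]]] := frame_system_exists openU scU
    smooth_a smooth_b smooth_c smooth_l smooth_m integrable.
  exists (fun q => vec3 (x q) (y q) (z q)).
  exact: (frame_system_surface openU sx sy sz c_neq0 sys).
move=> F F' nF cF nF' cF'.
have sys := surface_frame_system openU nF cF.
have sys' := surface_frame_system openU nF' cF'.
have vec3K (w : 'rV[R]_3) : vec3 (xc w) (yc w) (zc w) = w.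
  by apply: space_ext; rewrite vec3E.
(* An empty [U] counts as simply connected; with no base point available, the identity motion is
   taken. *)
have [[q0 Uq0]|U0] := pselect (exists q, U q); last first.
  exists (rigid 1 0 0 0 0); split=> [|q Uq]; last by case: U0; exists q.
  by apply: PSH1_rigid; rewrite mulr1 mulr0 addr0.
have [al [be [x0 [y0 [z0 [ab1 E]]]]]] := frame_system_unique openU scU.1 Uq0 sys sys'.
exists (rigid al be x0 y0 z0); split=> [|q Uq]; first exact: PSH1_rigid.
by rewrite -[F' q]vec3K -[F q]vec3K; exact: E.
Qed.
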